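(* Let $a\ge b>0$, $s>0$, $s\neq 1$, and let $L_{(s)}$ denote the perimeter of the superellipse $\mathscr{C}_s(a,b)$. Set $\alpha:=1+\frac1s$ and, for $k\in\mathbb{N}_0=\{0,1,2,\dots\}$, define $$v_k^{+}=\frac{1+2k(s-1)}{s},\qquad u_k^{+}=\frac{sk+1}{2(s-1)},\qquad v_k^{-}=1+\frac{2k(1-s)}{s},\qquad u_k^{-}=\frac{s(k+1)}{2(1-s)}.$$ Then the perimeter admits the following representations. (A) Positive branch. If $s>1$, then $L_{(s)}=L^+_{(s)}$, where $$L^+_{(s)}=\frac{4a}{s}\sum_{k=0}^\infty\frac{(-1)^k(-1/2)_k}{k!}\left(\frac ba\right)^{2k}\frac{1}{v^+_k}\,{}_2F_1\left(\alpha,v^+_k;v^+_k+1;-1\right)+\frac{2b}{s-1}\sum_{k=0}^\infty\frac{(-1)^k(\alpha)_k}{k!}\frac1{u^+_k}\,{}_2F_1\left(-\tfrac12,u^+_k;u^+_k+1;-\tfrac{a^2}{b^2}\right).$$ (B) Negative branch. If $0<s<1$, then $L_{(s)}=L^-_{(s)}$, where $$L^-_{(s)}=\frac{4a}{s}\sum_{k=0}^\infty\frac{(-1)^k(-1/2)_k}{k!}\left(\frac ba\right)^{2k}\frac{1}{v^-_k}\,{}_2F_1\left(\alpha,v^-_k;v^-_k+1;-1\right)+\frac{2b}{1-s}\sum_{k=0}^\infty\frac{(-1)^k(\alpha)_k}{k!}\frac1{u^-_k}\,{}_2F_1\left(-\tfrac12,u^-_k;u^-_k+1;-\tfrac{a^2}{b^2}\right),$$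 with the equality understood in the Abel-regularized sense.
   Context: For $a,b,s>0$, the superellipse (Lamé curve) $\mathscr{C}_s(a,b)$ is the closed plane curve given in polar coordinates by $r=r_{a,b}(\theta)=\left(\frac{|\cos\theta|^s}{a^s}+\frac{|\sin\theta|^s}{b^s}\right)^{-1/s}$, $0\le\theta<2\pi$. Its perimeter is its total arc length. $(q)_k=\Gamma(q+k)/\Gamma(q)$ is the Pochhammer symbol (rising factorial). ${}_2F_1$ is the Gauss hypergeometric function, defined by the power series $\sum_n\frac{(A)_n(B)_n}{(C)_n}\frac{z^n}{n!}$ where it converges, and understood outside its domain of convergence by analytic continuation (to $\mathbb{C}\setminus[1,\infty)$), e.g. via Euler's integral representation or Pfaff's transformation. Abel-regularized sense: an infinite series $\sum_k c_k$ is replaced by $\lim_{\varepsilon\to1^-}\sum_k c_k\varepsilon^k$, $0<\varepsilon<1$ (that is, $(-1)^k$ is replaced by $(-\varepsilon)^k$ and then $\varepsilon\to1^-$). *)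

(* Defs.v *)
From Stdlib Require Import Reals Factorial ClassicalEpsilon.
From Coquelicot Require Import Coquelicot.
Open Scope R_scope.

(** [x^p] for [x >= 0] and [p > 0]. [Rpower 0 p] is [exp (p * ln 0) = 1]
    because [ln] is [0] outside [(0, +oo)], whereas [0^p = 0] is needed. *)
Definition rpow (x p : R) : R :=
  if Rlt_dec 0 x then Rpower x p else 0.

Definition superellipse_radius (a b s theta : R) : R :=
  Rpower (rpow (Rabs (cos theta)) s / rpow a s
          + rpow (Rabs (sin theta)) s / rpow b s) (- (1 / s)).

Definition superellipse (a b s theta : R) : R * R :=
  (superellipse_radius a b s theta * cos theta,
   superellipse_radius a b s theta * sin theta).

(** The subdivision is [c = t 0 <= t 1 <= ... <= t (S n) = d]; recall that
    [sum_n u n] has the [n + 1] terms [u 0, ..., u n]. *)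
Definition is_inscribed_length (gamma : R -> R * R) (c d l : R) : Prop :=
  exists (n : nat) (t : nat -> R),
    t 0%nat = c /\ t (S n) = d /\
    (forall i, (i <= n)%nat -> t i <= t (S i)) /\
    l = sum_n (fun i => dist_euc (fst (gamma (t i))) (snd (gamma (t i)))
                          (fst (gamma (t (S i)))) (snd (gamma (t (S i))))) n.

(** Equal to [p_infty] when the curve is not rectifiable. *)
Definition arc_length (gamma : R -> R * R) (c d : R) : Rbar :=
  Lub_Rbar (is_inscribed_length gamma c d).

Definition perimeter (a b s : R) : Rbar :=
  arc_length (superellipse a b s) 0 (2 * PI).

(** [Gamma (q + k) / Gamma q = q (q + 1) ... (q + k - 1)]; the product also
    makes sense where [Gamma] has a pole. *)
Fixpoint pochhammer (q : R) (k : nat) : R :=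
  match k with
  | O => 1
  | S j => pochhammer q j * (q + INR j)
  end.

Definition hyp2F1_coef (A B C : R) (n : nat) : R :=
  pochhammer A n * pochhammer B n / (pochhammer C n * INR (fact n)).

Definition analytic_at (f : R -> R) (x : R) : Prop :=
  exists (c : nat -> R) (rho : posreal),
    forall y, Rabs (y - x) < rho -> is_pseries c (y - x) (f y).

(** All parameters and arguments are real here. The slit plane
    [C \ [1, +oo)] is star-shaped about [0] and meets the real line in
    [(-oo, 1)], so for real [x < 1] the value at [x] of the analytic
    continuation to the slit plane is obtained by continuing along the segment
    from [0] to [x], that is, by real-analytic continuation of the Gauss series
    from [(-1, 1)] to [(-oo, 1)]. The latter is unique by the identity
    theorem. *)
Definition is_hyp2F1 (A B C : R) (F : R -> R) : Prop :=
  (forall x, Rabs x < 1 -> is_pseries (hyp2F1_coef A B C) x (F x)) /\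
  (forall x, x < 1 -> analytic_at F x).

(** Meaningful for arguments [x < 1] and [C] not in [{0, -1, -2, ...}]. *)
Definition hyp2F1 (A B C : R) : R -> R :=
  epsilon (inhabits (fun _ : R => 0)) (is_hyp2F1 A B C).

Definition is_abel_sum (c : nat -> R) (l : R) : Prop :=
  (forall eps, 0 < eps < 1 -> ex_series (fun k => c k * eps ^ k)) /\
  filterlim (fun eps => Series (fun k => c k * eps ^ k))
    (at_left 1) (locally l).

Definition alpha (s : R) : R := 1 + 1 / s.

Definition v_plus (s : R) (k : nat) : R := (1 + 2 * INR k * (s - 1)) / s.
Definition u_plus (s : R) (k : nat) : R := (s * INR k + 1) / (2 * (s - 1)).
Definition v_minus (s : R) (k : nat) : R := 1 + 2 * INR k * (1 - s) / s.
Definition u_minus (s : R) (k : nat) : R := s * (INR k + 1) / (2 * (1 - s)).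

Definition first_term (a b s : R) (v : nat -> R) (k : nat) : R :=
  (-1) ^ k * pochhammer (- (1 / 2)) k / INR (fact k) * (b / a) ^ (2 * k)
  * (1 / v k) * hyp2F1 (alpha s) (v k) (v k + 1) (-1).

Definition second_term (a b s : R) (u : nat -> R) (k : nat) : R :=
  (-1) ^ k * pochhammer (alpha s) k / INR (fact k)
  * (1 / u k) * hyp2F1 (- (1 / 2)) (u k) (u k + 1) (- (a ^ 2 / b ^ 2)).

(* Main.v *)
(** The axes and the rays [|y| / |x| = b / a] cut the superellipse into eight
    arcs, of two congruence types exchanged by swapping [a] and [b]. An arc is
    [C^1] in the parameter [w] given by [y / x = (b / a) w^kappa], where
    [kappa = 1] if [s > 1] and [kappa = 1 / s] if [s < 1]. Its length is
    a constant times the integral over [[0, 1]] of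
    [(1 + w^tau1)^(-alpha) sqrt (1 + c w^tau2)].
    Expanding the square root (for [c = (b/a)^2 <= 1]) or the other factor (for
    [c = (a/b)^2]) into its binomial series leaves in each term Euler's integral
    for [2F1 (A, v; v + 1; x)]. The Lagrange remainder
    [|(q)_(n+1)| / (n+1)! z^(n+1)] of the binomial series, integrated against
    [z = w^tau], tends to [0] because [|(q)_n| / n! = o(n)] for [|q| < 2]; this
    covers [q = alpha] exactly when [s > 1]. With the factor [eps^k] it always
    tends to [0], and the integral depends continuously on [eps]. *)

(* Length is a supremum over inscribed polygons, so monotone changes of parameter and isometries
   suffice to pass from the polar angle to [w] and from one octant to the others. The parameter [w]
   is made so that no improper integral occurs. The velocity is (1 + w^(kappa s))^(-alpha) times
   multiples of w^(kappa s - 1) and w^(kappa - 1); kappa = max(1, 1/s) is the least exponent that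
   keeps both powers continuous at 0, and it turns one of them into 1, which produces the root of 1
   + c w^tau2. Euler's integral is also taken in [w], since its usual weight t^(v-1) is singular at
   0 when v < 1. As [hyp2F1] is chosen by a specification, its values are reached by showing that
   Euler's integral meets this specification and that the specification determines the function on x
   < 1. *)
Require Import Defs.
From Stdlib Require Import Reals Lra Lia Factorial ClassicalEpsilon.
From Coquelicot Require Import Coquelicot.
Open Scope R_scope.

(* [ring] and [field] do not see through the carriers of Coquelicot's algebraic
   structures. *)
Ltac eq_R := match goal with |- ?x = ?y => change (@eq R x y) end.

(** * Polygons inscribed in a curve *)

Definition pdist (p q : R * R) : R := dist_euc (fst p) (snd p) (fst q) (snd q).

Lemma pdist_sym p q : pdist p q = pdist q p.
Proof. apply distance_symm. Qed.

Lemma pdist_triangle p q r : pdist p r <= pdist p q + pdist q r.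
Proof. apply triangle. Qed.

(** Inscribed lengths generated chord by chord from the left: cutting, joining and transporting
    subdivisions become inductions, with no reindexing of the sequence [t]. *)
Inductive polygon (gamma : R -> R * R) : R -> R -> R -> Prop :=
| polygon_chord c d : c <= d -> polygon gamma c d (pdist (gamma c) (gamma d))
| polygon_cons c m d l : c <= m -> polygon gamma m d l ->
    polygon gamma c d (pdist (gamma c) (gamma m) + l).

Lemma polygon_le gamma c d l : polygon gamma c d l -> c <= d.
Proof. induction 1; lra. Qed.

Lemma inscribed_polygon gamma c d l :
  is_inscribed_length gamma c d l <-> polygon gamma c d l.
Proof.
split.
- intros (n & t & <- & <- & Ht & ->); revert t Ht.
  induction n as [|n IH]; intros t Ht.
  + rewrite sum_O; apply polygon_chord, Ht; lia.
  + unfold sum_n; rewrite sum_Sn_m by lia; rewrite <- sum_n_m_S.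
    apply polygon_cons; [apply Ht; lia|].
    apply (IH (fun i => t (S i))); intros i Hi; apply Ht; lia.
- induction 1 as [c d H | c m d l H _ (n & t & H0 & H1 & Ht & ->)].
  + exists 0%nat, (fun i => match i with O => c | _ => d end).
    repeat split; trivial.
    * now intros [|i] Hi; [|lia].
    * now rewrite sum_O.
  + exists (S n), (fun i => match i with O => c | S j => t j end).
    repeat split; trivial.
    * intros [|i] Hi; [now rewrite H0 | apply Ht; lia].
    * unfold sum_n; rewrite (sum_Sn_m _ 0 (S n)) by lia; rewrite <- sum_n_m_S.
      now rewrite H0.
Qed.

Lemma polygon_cat gamma c d e l1 l2 :
  polygon gamma c d l1 -> polygon gamma d e l2 -> polygon gamma c e (l1 + l2).
Proof.
induction 1 as [c d H | c m d l H _ IH]; intros H2.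
- now apply polygon_cons.
- rewrite Rplus_assoc; apply polygon_cons; auto.
Qed.

(** By the triangle inequality the inserted vertex [d] can only lengthen the polygon, so upper
    bounds on the two halves bound the whole. *)
Lemma polygon_split gamma c e l d :
  polygon gamma c e l -> c <= d <= e ->
  exists l1 l2, polygon gamma c d l1 /\ polygon gamma d e l2 /\ l <= l1 + l2.
Proof.
induction 1 as [c e H | c m e l H Hp IH]; intros Hd.
- exists (pdist (gamma c) (gamma d)), (pdist (gamma d) (gamma e)).
  repeat split; try (apply polygon_chord; lra); apply pdist_triangle.
- destruct (Rle_dec d m) as [Hm|Hm].
  + exists (pdist (gamma c) (gamma d)), (pdist (gamma d) (gamma m) + l).
    split; [apply polygon_chord; lra|].
    split; [now apply polygon_cons|].
    generalize (pdist_triangle (gamma c) (gamma d) (gamma m)); lra.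
  + destruct IH as (l1 & l2 & H1 & H2 & H3); [lra|].
    exists (pdist (gamma c) (gamma m) + l1), l2.
    split; [now apply polygon_cons|]; split; [trivial|lra].
Qed.

Lemma polygon_monotone g1 g2 phi c d l :
  (forall x y, c <= x -> x <= y -> y <= d -> phi x <= phi y) ->
  (forall x, c <= x <= d -> g2 (phi x) = g1 x) ->
  polygon g1 c d l -> polygon g2 (phi c) (phi d) l.
Proof.
intros Hphi Hg Hp; induction Hp as [c d H | c m d l H Hp IH].
- rewrite <- !Hg by lra; apply polygon_chord, Hphi; lra.
- generalize (polygon_le _ _ _ _ Hp); intros Hd.
  rewrite <- !Hg by lra; apply polygon_cons; [apply Hphi; lra|].
  apply IH; [intros; apply Hphi | intros; apply Hg]; lra.
Qed.

(** Reversal puts the first chord last, hence [polygon_cat]. Asking for equal chords rather than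
    equal points lets [g2] be a mirror image of [g1]. *)
Lemma polygon_reflect g1 g2 K c d l :
  (forall x y, c <= x <= d -> c <= y <= d ->
     pdist (g2 (K - x)) (g2 (K - y)) = pdist (g1 x) (g1 y)) ->
  polygon g1 c d l -> polygon g2 (K - d) (K - c) l.
Proof.
intros Hg Hp; induction Hp as [c d H | c m d l H Hp IH].
- rewrite pdist_sym, <- Hg by lra; apply polygon_chord; lra.
- generalize (polygon_le _ _ _ _ Hp); intros Hd.
  rewrite Rplus_comm; apply polygon_cat with (K - m).
  + apply IH; intros; apply Hg; lra.
  + rewrite pdist_sym, <- Hg by lra; apply polygon_chord; lra.
Qed.

(** The supremum as a real number, in a form that adds up over consecutive arcs by halving [eps]. *)
Definition has_length (gamma : R -> R * R) (c d L : R) : Prop :=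
  (forall l, polygon gamma c d l -> l <= L) /\
  (forall eps, 0 < eps -> exists l, polygon gamma c d l /\ L - eps < l).

Lemma has_length_arc_length gamma c d L :
  has_length gamma c d L -> arc_length gamma c d = Finite L.
Proof.
intros [H1 H2]; apply is_lub_Rbar_unique; split.
- intros l Hl; apply H1; now apply inscribed_polygon.
- intros [b| |] Hb; simpl; trivial.
  + destruct (Rle_lt_dec L b) as [|Hlt]; trivial.
    destruct (H2 (L - b)) as (l & Hl & Hl'); [lra|].
    specialize (Hb l (proj2 (inscribed_polygon _ _ _ _) Hl)); simpl in Hb; lra.
  + destruct (H2 1) as (l & Hl & _); [lra|].
    exact (Hb l (proj2 (inscribed_polygon _ _ _ _) Hl)).
Qed.

Lemma has_length_cat gamma c d e L1 L2 : c <= d <= e ->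
  has_length gamma c d L1 -> has_length gamma d e L2 ->
  has_length gamma c e (L1 + L2).
Proof.
intros Hd [A1 A2] [B1 B2]; split.
- intros l Hl; destruct (polygon_split _ _ _ _ d Hl Hd) as (l1 & l2 & P1 & P2 & H).
  specialize (A1 _ P1); specialize (B1 _ P2); lra.
- intros eps He.
  destruct (A2 (eps / 2)) as (l1 & P1 & Q1); [lra|].
  destruct (B2 (eps / 2)) as (l2 & P2 & Q2); [lra|].
  exists (l1 + l2); split; [now apply polygon_cat with d | lra].
Qed.

Lemma has_length_reparam g1 g2 phi psi c d c' d' L :
  phi c = c' -> phi d = d' -> psi c' = c -> psi d' = d ->
  (forall x y, c <= x -> x <= y -> y <= d -> phi x <= phi y) ->
  (forall x y, c' <= x -> x <= y -> y <= d' -> psi x <= psi y) ->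
  (forall x, c <= x <= d -> g2 (phi x) = g1 x) ->
  (forall x, c' <= x <= d' -> g1 (psi x) = g2 x) ->
  has_length g1 c d L -> has_length g2 c' d' L.
Proof.
intros <- <- E3 E4 M1 M2 G1 G2 [H1 H2]; split.
- intros l Hl; apply H1; rewrite <- E3, <- E4.
  now apply polygon_monotone with g2.
- intros eps He; destruct (H2 eps He) as (l & Hl & Hl').
  exists l; split; trivial; now apply polygon_monotone with g1.
Qed.

Lemma has_length_reflect g1 g2 K c d L :
  (forall x y, c <= x <= d -> c <= y <= d ->
     pdist (g2 (K - x)) (g2 (K - y)) = pdist (g1 x) (g1 y)) ->
  has_length g1 c d L -> has_length g2 (K - d) (K - c) L.
Proof.
intros Hg [H1 H2]; split.
- intros l Hl; apply H1.
  replace c with (K - (K - c)) by ring; replace d with (K - (K - d)) by ring.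
  apply polygon_reflect with g2; trivial.
  intros x y Hx Hy; rewrite <- Hg by lra; do 2 f_equal; f_equal; ring.
- intros eps He; destruct (H2 eps He) as (l & Hl & Hl').
  exists l; split; trivial; now apply polygon_reflect with g1.
Qed.

(** * Length of a continuously differentiable curve *)

Lemma MVT_open (f df : R -> R) a b : a < b ->
  (forall x, a < x < b -> is_derive f x (df x)) ->
  (forall x, a <= x <= b -> continuous f x) ->
  exists c, a <= c <= b /\ f b - f a = df c * (b - a).
Proof.
intros Hab Hd Hc; destruct (MVT_gen f a b df) as (c & H1 & H2).
- intros x; rewrite Rmin_left, Rmax_right by lra; apply Hd.
- intros x; rewrite Rmin_left, Rmax_right by lra; intros Hx.
  apply continuity_pt_filterlim, Hc; lra.
- rewrite Rmin_left, Rmax_right in H1 by lra; now exists c.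
Qed.

Lemma is_derive_RInt_continuous (f : R -> R) a x : (forall t, continuous f t) ->
  is_derive (fun t => RInt f a t) x (f x).
Proof.
intros Hf; apply is_derive_RInt with a; [|apply Hf].
exists (mkposreal 1 Rlt_0_1); intros y _.
apply @RInt_correct, @ex_RInt_continuous; intros; apply Hf.
Qed.

(** [F] minus the integral has derivative 0 inside and is continuous up to the ends. Derivatives are
    asked only inside because those of [pw] are available only at positive arguments. *)
Lemma RInt_derive_open (F f : R -> R) a b : a < b ->
  (forall x, continuous f x) ->
  (forall x, a < x < b -> is_derive F x (f x)) ->
  (forall x, a <= x <= b -> continuous F x) ->
  RInt f a b = F b - F a.
Proof.
intros Hab Hf Hd Hc.
destruct (MVT_open (fun x => F x - RInt f a x) (fun _ => 0) a b Hab) as (c & _ & H).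
- intros x Hx; replace 0 with (f x - f x) by ring.
  apply @is_derive_minus; [now apply Hd | now apply is_derive_RInt_continuous].
- intros x Hx; apply @continuous_minus; [now apply Hc|].
  apply @ex_derive_continuous; eexists; now apply is_derive_RInt_continuous.
- rewrite RInt_point in H; unfold zero in H; simpl in H; lra.
Qed.

Lemma norm2_triangle x y u v :
  sqrt ((x + u)² + (y + v)²) <= sqrt (x² + y²) + sqrt (u² + v²).
Proof.
generalize (triangle 0 0 (x + u) (y + v) x y); unfold dist_euc.
replace (0 - (x + u))² with (x + u)² by (unfold Rsqr; ring).
replace (0 - (y + v))² with (y + v)² by (unfold Rsqr; ring).
replace (0 - x)² with x² by (unfold Rsqr; ring).
replace (0 - y)² with y² by (unfold Rsqr; ring).
replace (x - (x + u))² with u² by (unfold Rsqr; ring).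
now replace (y - (y + v))² with v² by (unfold Rsqr; ring).
Qed.

Lemma norm2_perturb x y u v e : Rabs u <= e -> Rabs v <= e ->
  sqrt ((x + u)² + (y + v)²) <= sqrt (x² + y²) + 2 * e.
Proof.
intros Hu Hv; generalize (norm2_triangle x y u v).
assert (sqrt (u² + v²) <= 2 * e); [|lra].
assert (0 <= e) by (generalize (Rabs_pos u); lra).
rewrite <- (sqrt_Rsqr (2 * e)) by lra; apply sqrt_le_1_alt.
assert (u² <= e²) by (apply Rsqr_le_abs_1; now rewrite (Rabs_pos_eq e)).
assert (v² <= e²) by (apply Rsqr_le_abs_1; now rewrite (Rabs_pos_eq e)).
unfold Rsqr in *; nra.
Qed.

Section SmoothCurve.

Variables (x y x' y' : R -> R) (c d : R).
Hypothesis hcd : c < d.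
Hypothesis x_cont : forall t, c <= t <= d -> continuous x t.
Hypothesis y_cont : forall t, c <= t <= d -> continuous y t.
Hypothesis x_deriv : forall t, c < t < d -> is_derive x t (x' t).
Hypothesis y_deriv : forall t, c < t < d -> is_derive y t (y' t).
Hypothesis x'_cont : forall t, continuous x' t.
Hypothesis y'_cont : forall t, continuous y' t.

Let gamma t := (x t, y t).
Let speed t := sqrt ((x' t)² + (y' t)²).
Let arc u := RInt speed c u.

Lemma continuous_speed t : continuous speed t.
Proof.
unfold speed; apply continuous_comp with (g := sqrt).
- apply @continuous_plus; now apply @continuous_mult.
- apply continuous_sqrt.
Qed.

Lemma is_derive_arc t : is_derive arc t (speed t).
Proof. apply is_derive_RInt_continuous, continuous_speed. Qed.

Lemma arc_cont t : continuous arc t.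
Proof. apply @ex_derive_continuous; eexists; apply is_derive_arc. Qed.

(* With [p] the unit vector along the chord, [t |-> <p, gamma t> - arc t] is
   nonincreasing. *)
Lemma chord_le u v : c <= u -> u <= v -> v <= d ->
  pdist (gamma u) (gamma v) <= arc v - arc u.
Proof.
intros Hu Huv Hv; unfold pdist, gamma; simpl; unfold dist_euc.
set (D := sqrt _).
destruct (Req_dec u v) as [<-|Huv'].
{ unfold D; rewrite !Rminus_diag, Rsqr_0, Rplus_0_l, sqrt_0; lra. }
assert (HD : 0 <= D) by apply sqrt_pos.
assert (E : D * D = (x u - x v)² + (y u - y v)²).
{ apply sqrt_sqrt; generalize (Rle_0_sqr (x u - x v)) (Rle_0_sqr (y u - y v)); lra. }
destruct (Req_dec D 0) as [E0|HD0].
- rewrite E0; destruct (MVT_open arc speed u v) as (z & _ & Hz); [lra| | |].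
  + intros; apply is_derive_arc.
  + intros; apply arc_cont.
  + rewrite Hz; apply Rmult_le_pos; [apply sqrt_pos|lra].
- set (p := (x v - x u) / D); set (q := (y v - y u) / D).
  assert (Hpq : sqrt (p² + q²) = 1).
  { rewrite <- sqrt_1; f_equal; unfold p, q, Rsqr.
    transitivity ((D * D) / (D * D)); [rewrite E at 1; unfold Rsqr; now field|now field]. }
  destruct (MVT_open (fun t => p * x t + q * y t - arc t)
             (fun t => p * x' t + q * y' t - speed t) u v) as (z & _ & Hz); [lra| | |].
  + intros t Ht; apply @is_derive_minus; [|apply is_derive_arc].
    apply @is_derive_plus; apply is_derive_scal; [apply x_deriv|apply y_deriv]; lra.
  + intros t Ht; apply @continuous_minus; [|apply arc_cont].
    apply @continuous_plus; apply @continuous_scal_r;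
      [apply x_cont|apply y_cont]; lra.
  + assert (Hpos : p * x' z + q * y' z - speed z <= 0).
    { generalize (sqrt_cauchy p q (x' z) (y' z)); rewrite Hpq; unfold speed; lra. }
    assert (HDpq : D = p * (x v - x u) + q * (y v - y u)).
    { apply Rmult_eq_reg_r with D; trivial; unfold p, q; rewrite E; unfold Rsqr; now field. }
    assert (0 <= v - u) by lra.
    nra.
Qed.

(** The mean value theorem gives a different intermediate point for each coordinate and for [arc];
    the oscillation bound [e] makes the velocities at these points comparable. *)
Lemma chord_ge e u v : 0 < e -> c <= u -> u <= v -> v <= d ->
  (forall t z, u <= t <= v -> u <= z <= v ->
     Rabs (x' t - x' z) <= e /\ Rabs (y' t - y' z) <= e) ->
  arc v - arc u - 2 * e * (v - u) <= pdist (gamma u) (gamma v).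
Proof.
intros He Hu Huv Hv Hosc; unfold pdist, gamma; simpl; unfold dist_euc.
destruct (Req_dec u v) as [<-|Huv'].
{ generalize (sqrt_pos ((x u - x u)² + (y u - y u)²)); lra. }
destruct (MVT_open arc speed u v) as (z & Hz1 & Hz); [lra| | |].
{ intros; apply is_derive_arc. }
{ intros; apply arc_cont. }
destruct (MVT_open x x' u v) as (t1 & Ht1 & E1); [lra| | |].
{ intros; apply x_deriv; lra. }
{ intros; apply x_cont; lra. }
destruct (MVT_open y y' u v) as (t2 & Ht2 & E2); [lra| | |].
{ intros; apply y_deriv; lra. }
{ intros; apply y_cont; lra. }
replace ((x u - x v)² + (y u - y v)²)
  with ((v - u)² * ((x' t1)² + (y' t2)²)).
2:{ replace (x u - x v) with (- (x' t1 * (v - u))) by lra.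
    replace (y u - y v) with (- (y' t2 * (v - u))) by lra. unfold Rsqr; ring. }
rewrite sqrt_mult_alt by apply Rle_0_sqr.
rewrite sqrt_Rsqr by lra; rewrite Hz.
generalize (norm2_perturb (x' t1) (y' t2) (x' z - x' t1) (y' z - y' t2) e
  (proj1 (Hosc z t1 Hz1 Ht1)) (proj2 (Hosc z t2 Hz1 Ht2))).
replace (x' t1 + (x' z - x' t1)) with (x' z) by ring.
replace (y' t2 + (y' z - y' t2)) with (y' z) by ring.
fold (speed z); assert (0 < v - u) by lra; nra.
Qed.

Lemma polygon_le_arc u v l : polygon gamma u v l -> c <= u -> v <= d ->
  l <= arc v - arc u.
Proof.
induction 1 as [u v H | u m v l H Hp IH]; intros Hu Hv.
- now apply chord_le.
- generalize (polygon_le _ _ _ _ Hp); intros Hm.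
  assert (l <= arc v - arc m) by (apply IH; lra).
  generalize (chord_le u m Hu H); lra.
Qed.

Lemma arc_le_polygon e delta n u v : 0 < e ->
  (forall t z, c <= t <= d -> c <= z <= d -> Rabs (t - z) < delta ->
     Rabs (x' t - x' z) <= e /\ Rabs (y' t - y' z) <= e) ->
  c <= u -> u <= v -> v <= d -> v - u < (INR n + 1) * delta ->
  exists l, polygon gamma u v l /\ arc v - arc u - 2 * e * (v - u) <= l.
Proof.
intros He Hosc; revert u; induction n as [|n IH]; intros u Hu Huv Hv Hn.
- exists (pdist (gamma u) (gamma v)); split; [now apply polygon_chord|].
  apply chord_ge; trivial; simpl in Hn; intros t z Ht Hz.
  apply Hosc; try lra; apply Rabs_def1; lra.
- rewrite S_INR in Hn.
  assert (0 <= INR n) by apply pos_INR.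
  (* The first of n + 2 equal pieces; the other n + 1 are left to the induction hypothesis. *)
  set (m := u + (v - u) / (INR n + 2)).
  assert (Hm : m - u = (v - u) / (INR n + 2)) by (unfold m; ring).
  assert (Hm' : (INR n + 2) * (m - u) = v - u) by (rewrite Hm; field; lra).
  assert (m - u < delta) by (apply Rmult_lt_reg_l with (INR n + 2); lra).
  assert (0 <= m - u) by (apply Rmult_le_reg_l with (INR n + 2); lra).
  assert (m <= v) by nra.
  destruct (IH m) as (l & Hl & Hl'); try lra.
  { replace (v - m) with ((v - u) - (m - u)) by ring.
    apply Rmult_lt_reg_l with (INR n + 2); [lra|nra]. }
  exists (pdist (gamma u) (gamma m) + l); split; [apply polygon_cons; [lra|trivial]|].
  assert (arc m - arc u - 2 * e * (m - u) <= pdist (gamma u) (gamma m)); [|lra].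
  apply chord_ge; try lra; intros t z Ht Hz.
  apply Hosc; try lra; apply Rabs_def1; lra.
Qed.

Lemma uniformly_continuous f e : 0 < e -> (forall t, continuous f t) ->
  exists delta, 0 < delta /\
    forall t z, c <= t <= d -> c <= z <= d -> Rabs (t - z) < delta ->
    Rabs (f t - f z) <= e.
Proof.
intros He Hf.
destruct (Heine f (fun t => c <= t <= d) (compact_P3 c d)) with (eps := mkposreal e He)
  as (delta & H).
- intros t _; apply continuity_pt_filterlim, Hf.
- exists delta; split; [apply cond_pos|].
  intros t z Ht Hz Htz; apply Rlt_le; now apply H.
Qed.

Lemma has_length_smooth : has_length gamma c d (RInt speed c d).
Proof.
assert (E : RInt speed c d = arc d - arc c).
{ assert (E0 : arc c = 0) by apply @RInt_point.
  rewrite E0; symmetry; apply Rminus_0_r. }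
rewrite E; split.
- intros l Hl; apply polygon_le_arc; trivial; lra.
- intros eps Heps.
  (* The deficits of the chords then add up to at most 2 e (d - c) = eps / 2. *)
  set (e := eps / (4 * (d - c))).
  assert (He : 0 < e) by (apply Rdiv_lt_0_compat; lra).
  destruct (uniformly_continuous x' e He x'_cont) as (d1 & Hd1 & H1).
  destruct (uniformly_continuous y' e He y'_cont) as (d2 & Hd2 & H2).
  set (delta := Rmin d1 d2).
  assert (Hdelta : 0 < delta) by now apply Rmin_glb_lt.
  destruct (nfloor_ex ((d - c) / delta)) as (n & _ & Hn).
  { apply Rlt_le, Rdiv_lt_0_compat; lra. }
  destruct (arc_le_polygon e delta n c d) as (l & Hl & Hl'); trivial; try lra.
  + intros t z Ht Hz Htz; split; [apply H1|apply H2]; trivial;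
      apply Rlt_le_trans with (1 := Htz); [apply Rmin_l|apply Rmin_r].
  + apply Rmult_lt_compat_r with (1 := Hdelta) in Hn.
    unfold Rdiv in Hn; rewrite Rmult_assoc, Rinv_l in Hn; lra.
  + exists l; split; trivial.
    replace (2 * e * (d - c)) with (eps / 2) in Hl' by (unfold e; field; lra).
    lra.
Qed.

End SmoothCurve.

(** * Nonnegative powers and term-by-term integration *)

(** [w^p] for [w >= 0] and [p >= 0], with [0^0 = 1]. *)
Definition pw (w p : R) : R := if Req_EM_T p 0 then 1 else rpow w p.

Lemma pw_pos w p : 0 < w -> pw w p = Rpower w p.
Proof.
intros Hw; unfold pw, rpow.
destruct (Req_EM_T p 0) as [->|_]; [now rewrite Rpower_O|].
destruct (Rlt_dec 0 w); tauto.
Qed.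

Lemma pw_0r w : pw w 0 = 1.
Proof. unfold pw; destruct (Req_EM_T 0 0); tauto. Qed.

Lemma pw_le0 w p : w <= 0 -> p <> 0 -> pw w p = 0.
Proof.
intros Hw Hp; unfold pw, rpow; destruct (Req_EM_T p 0); [tauto|].
destruct (Rlt_dec 0 w); [lra|trivial].
Qed.

Lemma pw_ge0 w p : 0 <= pw w p.
Proof.
unfold pw, rpow; destruct (Req_EM_T p 0); [lra|].
destruct (Rlt_dec 0 w); [left; apply exp_pos|lra].
Qed.

Lemma pw_1l p : pw 1 p = 1.
Proof.
rewrite pw_pos by lra; unfold Rpower; now rewrite ln_1, Rmult_0_r, exp_0.
Qed.

Lemma pw_1r w : 0 <= w -> pw w 1 = w.
Proof.
intros [H|<-]; [now rewrite pw_pos, Rpower_1 | apply pw_le0; lra].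
Qed.

Lemma pw_plus w p q : 0 <= p -> 0 <= q -> pw w (p + q) = pw w p * pw w q.
Proof.
intros Hp Hq; destruct (Rlt_dec 0 w) as [Hw|Hw].
- rewrite !pw_pos by trivial; apply Rpower_plus.
- destruct (Req_dec p 0) as [->|Hp'].
  { now rewrite Rplus_0_l, pw_0r, Rmult_1_l. }
  rewrite !(pw_le0 w (_ + _)), (pw_le0 w p) by lra; ring.
Qed.

Lemma pw_pow w p n : 0 <= p -> pw w p ^ n = pw w (p * INR n).
Proof.
intros Hp; induction n as [|n IH].
- now rewrite Rmult_0_r, pw_0r.
- rewrite S_INR, Rmult_plus_distr_l, Rmult_1_r, Rplus_comm, pw_plus, <- IH;
    trivial; apply Rmult_le_pos; trivial; apply pos_INR.
Qed.

Lemma pw_mult w p q : 0 < p -> 0 <= q -> pw (pw w p) q = pw w (p * q).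
Proof.
intros Hp Hq; destruct (Rlt_dec 0 w) as [Hw|Hw].
- rewrite (pw_pos w p), !pw_pos by (trivial; apply exp_pos); apply Rpower_mult.
- destruct (Req_dec q 0) as [->|Hq'].
  { now rewrite Rmult_0_r, !pw_0r. }
  assert (p * q <> 0) by (apply Rmult_integral_contrapositive; lra).
  rewrite !pw_le0; trivial; try lra; now rewrite pw_le0; try lra.
Qed.

Lemma pw_incr p u v : 0 <= p -> u <= v -> pw u p <= pw v p.
Proof.
intros Hp Huv; destruct (Rlt_dec 0 u) as [Hu|Hu].
- rewrite !pw_pos by lra; apply Rle_Rpower_l; lra.
- destruct (Req_dec p 0) as [->|Hp']; [rewrite !pw_0r; lra|].
  rewrite (pw_le0 u) by lra; apply pw_ge0.
Qed.

Lemma pw_le1 w p : 0 <= p -> w <= 1 -> pw w p <= 1.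
Proof. intros Hp Hw; rewrite <- (pw_1l p); now apply pw_incr. Qed.

Lemma is_derive_pw w p : 0 < w ->
  is_derive (fun x => pw x p) w (p * pw w (p - 1)).
Proof.
intros Hw; rewrite pw_pos by trivial.
apply is_derive_ext_loc with (fun x => Rpower x p).
- exists (mkposreal w Hw); intros x Hx.
  symmetry; apply pw_pos; apply Rabs_lt_between' in Hx; simpl in Hx; lra.
- now apply is_derive_Reals, derivable_pt_lim_power.
Qed.

(** For [p > 0] the extension by 0 to negative arguments is continuous, so velocities and integrands
    are continuous on the whole line, as [has_length_smooth] and [RInt_derive_open] ask. At 0 the
    modulus is eps^(1/p). *)
Lemma continuous_pw p w : 0 <= p -> continuous (fun x => pw x p) w.
Proof.
intros Hp.
destruct (Req_dec p 0) as [->|Hp'].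
{ apply continuous_ext with (fun _ => 1); [intros x; symmetry; apply pw_0r|].
  apply continuous_const. }
destruct (Rtotal_order w 0) as [Hw|[->|Hw]].
- apply continuous_ext_loc with (fun _ => 0); [|apply continuous_const].
  assert (Hw' : 0 < - w) by lra; exists (mkposreal _ Hw'); intros x Hx.
  symmetry; apply pw_le0; trivial.
  apply Rabs_lt_between' in Hx; simpl in Hx; lra.
- apply filterlim_locally; intros eps.
  exists (mkposreal (Rpower eps (/ p)) (exp_pos _)); intros x Hx.
  apply Rabs_lt_between' in Hx; simpl in Hx.
  rewrite (pw_le0 0) by lra; apply Rabs_lt_between'; split.
  + generalize (pw_ge0 x p) (cond_pos eps); lra.
  + rewrite Rplus_0_l; destruct (Rlt_dec 0 x) as [H|H].
    * rewrite pw_pos by trivial.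
      replace (pos eps) with (Rpower (Rpower eps (/ p)) p).
      2:{ rewrite Rpower_mult, Rinv_l, Rpower_1; trivial; apply cond_pos. }
      apply Rlt_Rpower_l; lra.
    * rewrite pw_le0 by lra; apply cond_pos.
- apply @ex_derive_continuous; eexists; now apply is_derive_pw.
Qed.

Lemma RInt_pw p : 0 <= p -> RInt (fun w => pw w p) 0 1 = 1 / (p + 1).
Proof.
intros Hp; rewrite RInt_derive_open with (F := fun w => pw w (p + 1) / (p + 1));
  [|lra| | |].
- rewrite pw_1l, pw_le0 by lra.
  change (1 / (p + 1) - 0 / (p + 1) = 1 / (p + 1)); field; lra.
- intros; now apply continuous_pw.
- intros x Hx; replace (pw x p) with (/ (p + 1) * ((p + 1) * pw x (p + 1 - 1))).
  + apply is_derive_ext with (fun w => / (p + 1) * pw w (p + 1)).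
    { intros t; unfold Rdiv; apply Rmult_comm. }
    apply is_derive_scal, is_derive_pw; lra.
  + replace (p + 1 - 1) with p by ring.
    simpl; field; lra.
- intros x _; apply @continuous_mult; [|apply continuous_const].
  apply continuous_pw; lra.
Qed.

Lemma continuous_Rpower (f : R -> R) p t :
  continuous f t -> 0 < f t -> continuous (fun x => Rpower (f x) p) t.
Proof.
intros Hf H; apply continuous_comp with (g := fun y => Rpower y p); trivial.
apply @ex_derive_continuous; eexists.
now apply is_derive_Reals, derivable_pt_lim_power.
Qed.

Lemma ex_RInt_01 (f : R -> R) :
  (forall t, 0 <= t <= 1 -> continuous f t) -> ex_RInt f 0 1.
Proof.
intros Hf; apply @ex_RInt_continuous; intros t.
rewrite Rmin_left, Rmax_right by lra; apply Hf.
Qed.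

Lemma continuous_sum_n (f : nat -> R -> R) t n :
  (forall k, continuous (f k) t) -> continuous (fun x => sum_n (fun k => f k x) n) t.
Proof.
intros Hf; induction n as [|n IH].
- apply continuous_ext with (f 0%nat); trivial; intros x; now rewrite sum_O.
- apply continuous_ext with (fun x => sum_n (fun k => f k x) n + f (S n) x).
  + intros x; now rewrite sum_Sn.
  + now apply @continuous_plus.
Qed.

Lemma sum_n_RInt (f : nat -> R -> R) n :
  (forall k t, 0 <= t <= 1 -> continuous (f k) t) ->
  sum_n (fun k => RInt (f k) 0 1) n = RInt (fun t => sum_n (fun k => f k t) n) 0 1.
Proof.
intros Hf; induction n as [|n IH].
- rewrite sum_O; apply RInt_ext; intros; now rewrite sum_O.
- rewrite sum_Sn, IH.
  rewrite <- (RInt_plus (V := R_CompleteNormedModule)).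
  + apply RInt_ext; intros; now rewrite sum_Sn.
  + apply ex_RInt_01; intros; apply continuous_sum_n; auto.
  + apply ex_RInt_01; auto.
Qed.

(** The error bounds have to vanish in mean, not uniformly: for q = alpha and c = 1 the Lagrange
    bounds at t = 1 do not tend to 0. *)
Lemma is_series_RInt (f : nat -> R -> R) (F : R -> R) (d : nat -> R -> R) :
  (forall k t, 0 <= t <= 1 -> continuous (f k) t) ->
  (forall t, 0 <= t <= 1 -> continuous F t) ->
  (forall k t, 0 <= t <= 1 -> continuous (d k) t) ->
  (forall n t, 0 <= t <= 1 -> Rabs (F t - sum_n (fun k => f k t) n) <= d n t) ->
  is_lim_seq (fun n => RInt (d n) 0 1) 0 ->
  is_series (fun k => RInt (f k) 0 1) (RInt F 0 1).
Proof.
intros Hf HF Hd Hb Hlim.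
enough (H : is_lim_seq (sum_n (fun k => RInt (f k) 0 1)) (RInt F 0 1)) by exact H.
replace (RInt F 0 1) with (RInt F 0 1 - 0) by ring.
apply is_lim_seq_ext with
  (fun n => RInt F 0 1 - (RInt F 0 1 - sum_n (fun k => RInt (f k) 0 1) n)).
{ intros; ring. }
apply is_lim_seq_minus'; [apply is_lim_seq_const|].
apply is_lim_seq_abs_0.
apply is_lim_seq_le_le with (2 := is_lim_seq_const 0) (3 := Hlim).
intros n; split; [apply Rabs_pos|].
rewrite sum_n_RInt by trivial.
assert (C : forall t, 0 <= t <= 1 -> continuous (fun t => sum_n (fun k => f k t) n) t).
{ intros; apply continuous_sum_n; auto. }
change (Rabs (minus (RInt F 0 1) (RInt (fun t => sum_n (fun k => f k t) n) 0 1))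
  <= RInt (d n) 0 1).
rewrite <- (RInt_minus (V := R_CompleteNormedModule)) by (now apply ex_RInt_01).
eapply Rle_trans; [apply abs_RInt_le; [lra|]|].
- apply ex_RInt_01; intros; apply @continuous_minus; auto.
- apply RInt_le; [lra| | |].
  + apply ex_RInt_01; intros.
    apply continuous_comp with (g := Rabs); [apply @continuous_minus; auto|].
    apply continuous_Rabs.
  + apply ex_RInt_01; auto.
  + intros t Ht; apply Hb; lra.
Qed.

(** * The binomial series and Euler's integral *)

(** The coefficient of z^n in (1 - z)^(-q); with the sign (-1)^n, that in (1 + z)^(-q). *)
Definition bin (q : R) (n : nat) : R := pochhammer q n / INR (fact n).

Lemma bin_O q : bin q 0 = 1.
Proof. unfold bin; simpl; field. Qed.

Lemma bin_S q n : bin q (S n) = bin q n * ((q + INR n) / (INR n + 1)).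
Proof.
unfold bin; rewrite fact_simpl, mult_INR, S_INR; simpl pochhammer.
generalize (INR_fact_neq_0 n) (pos_INR n); intros H1 H2.
field; split; lra.
Qed.

Lemma bin_gt0 m n : 0 < m -> 0 < bin m n.
Proof.
intros Hm; induction n as [|n IH]; [rewrite bin_O; lra|].
rewrite bin_S; generalize (pos_INR n); intros Hn.
apply Rmult_lt_0_compat; trivial; apply Rdiv_lt_0_compat; lra.
Qed.

Lemma bin_le q m n : Rabs q <= m -> Rabs (bin q n) <= bin m n.
Proof.
intros Hm; induction n as [|n IH]; [rewrite !bin_O, Rabs_R1; lra|].
generalize (pos_INR n); intros Hn.
rewrite !bin_S, Rabs_mult; apply Rmult_le_compat; trivial; try apply Rabs_pos.
unfold Rdiv; rewrite Rabs_mult, (Rabs_pos_eq (/ _)).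
2:{ left; apply Rinv_0_lt_compat; lra. }
apply Rmult_le_compat_r; [left; apply Rinv_0_lt_compat; lra|].
generalize (Rabs_triang q (INR n)); rewrite (Rabs_pos_eq (INR n)) by trivial; lra.
Qed.

Lemma is_lim_seq_bin_ratio m :
  is_lim_seq (fun n => (m + INR n) / (INR n + 1)) 1.
Proof.
apply is_lim_seq_ext with (fun n => 1 + (m - 1) * / (INR n + 1)).
{ intros n; generalize (pos_INR n); intros; field; lra. }
replace (Finite 1) with (Finite (1 + (m - 1) * 0)) by (f_equal; ring).
apply is_lim_seq_plus'; [apply is_lim_seq_const|].
apply is_lim_seq_mult'; [apply is_lim_seq_const|].
apply is_lim_seq_ext with (fun n => / INR (S n)); [intros; now rewrite S_INR|].
replace (Finite 0) with (Rbar_inv p_infty) by reflexivity.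
apply is_lim_seq_inv; [|discriminate].
apply -> (is_lim_seq_incr_1 INR); apply is_lim_seq_INR.
Qed.

Lemma CV_disk_bin q z : Rabs z < 1 -> CV_disk (bin q) z.
Proof.
(* The ratio test wants nonzero coefficients, but [bin q] vanishes eventually when [q] is 0 or a
   negative integer; a positive [m] above |q| gives a majorant. *)
intros Hz; set (m := Rabs q + 1).
assert (Hm : 0 < m) by (generalize (Rabs_pos q); unfold m; lra).
assert (H : CV_disk (bin m) z).
{ apply CV_disk_DAlembert with 1.
  - intros n; generalize (bin_gt0 m n Hm); lra.
  - apply is_lim_seq_ext with (2 := is_lim_seq_bin_ratio m).
    intros n; generalize (bin_gt0 m n Hm) (pos_INR n); intros H1 H2.
    rewrite bin_S, Rabs_pos_eq; [field; lra|].
    apply Rdiv_le_0_compat; trivial; apply Rmult_le_pos; [lra|].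
    apply Rdiv_le_0_compat; lra.
  - right; split; lra. }
unfold CV_disk in *; eapply @ex_series_le; [|exact H].
intros n; unfold norm; simpl; rewrite Rabs_Rabsolu, !Rabs_mult.
apply Rmult_le_compat_r; [apply Rabs_pos|].
rewrite (Rabs_pos_eq (bin m n)) by (left; now apply bin_gt0).
apply bin_le; unfold m; lra.
Qed.

Lemma CV_radius_bin q z : Rabs z < 1 -> Rbar_lt (Rabs z) (CV_radius (bin q)).
Proof.
intros Hz; generalize (Rabs_pos z); intros Hz0.
apply Rbar_lt_le_trans with (Finite ((Rabs z + 1) / 2)); [simpl; lra|].
apply (proj1 (Lub_Rbar_correct (CV_disk (bin q)))), CV_disk_bin.
rewrite Rabs_pos_eq; lra.
Qed.

(** The recursion (n + 1) bin q (n + 1) = (q + n) bin q n, read as a differential equation. *)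
Lemma PSeries_bin_ode q z : Rabs z < 1 ->
  (1 - z) * PSeries (PS_derive (bin q)) z = q * PSeries (bin q) z.
Proof.
intros Hz; generalize (CV_radius_bin q z Hz); intros HR.
assert (E : PSeries (PS_derive (bin q)) z
  = q * PSeries (bin q) z + z * PSeries (PS_derive (bin q)) z); [|lra].
rewrite <- PSeries_scal, <- PSeries_incr_1, <- PSeries_plus.
- apply PSeries_ext; intros n.
  transitivity (q * bin q n + INR n * bin q n).
  + unfold PS_derive; rewrite bin_S, S_INR.
    generalize (pos_INR n); intros Hn; field; lra.
  + change (q * bin q n + INR n * bin q n
      = q * bin q n + PS_incr_1 (PS_derive (bin q)) n).
    f_equal; destruct n as [|n]; [apply Rmult_0_l|reflexivity].
- apply @ex_pseries_scal; [intros; apply Rmult_comm|].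
  now apply CV_radius_inside.
- apply @ex_pseries_incr_1; now apply ex_pseries_derive.
Qed.

Lemma is_derive_Rpower_comp (f : R -> R) df p t :
  is_derive f t df -> 0 < f t ->
  is_derive (fun x => Rpower (f x) p) t (df * (p * Rpower (f t) (p - 1))).
Proof.
intros Hf H.
apply (is_derive_comp (fun y => Rpower y p)); trivial.
now apply is_derive_Reals, derivable_pt_lim_power.
Qed.

(** By [PSeries_bin_ode] the product of the series and (1 - z)^q has derivative 0, so it keeps its
    value 1 at 0. *)
Lemma binomial_series q z : Rabs z < 1 -> is_pseries (bin q) z (Rpower (1 - z) (- q)).
Proof.
intros Hz.
enough (E : PSeries (bin q) z * Rpower (1 - z) q = 1).
{ replace (Rpower (1 - z) (- q)) with (PSeries (bin q) z).
  - apply PSeries_correct, CV_radius_inside; now apply CV_radius_bin.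
  - rewrite Rpower_Ropp; apply Rmult_eq_reg_r with (Rpower (1 - z) q).
    + rewrite E; field; apply Rgt_not_eq, exp_pos.
    + apply Rgt_not_eq, exp_pos. }
set (f := fun x => PSeries (bin q) x * Rpower (1 - x) q).
assert (D : forall x, Rabs x < 1 -> is_derive f x 0).
{ intros x Hx.
  assert (x < 1) by (apply Rabs_def2 in Hx; lra).
  replace 0 with (PSeries (PS_derive (bin q)) x * Rpower (1 - x) q
    + PSeries (bin q) x * ((-1) * (q * Rpower (1 - x) (q - 1)))).
  - apply (is_derive_mult (PSeries (bin q)) (fun y => Rpower (1 - y) q)).
    + now apply is_derive_PSeries, CV_radius_bin.
    + apply (is_derive_Rpower_comp (fun y => 1 - y)); [|lra].
      auto_derive; trivial; ring.
    + intros; apply Rmult_comm.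
  - replace (Rpower (1 - x) q) with ((1 - x) * Rpower (1 - x) (q - 1)).
    + transitivity (Rpower (1 - x) (q - 1) *
        ((1 - x) * PSeries (PS_derive (bin q)) x - q * PSeries (bin q) x)); [ring|].
      rewrite PSeries_bin_ode by trivial; ring.
    + rewrite <- (Rpower_1 (1 - x)) at 1 by lra; rewrite <- Rpower_plus; f_equal; ring. }
assert (H0 : f 0 = 1).
{ unfold f; rewrite PSeries_0, bin_O, Rminus_0_r; unfold Rpower.
  rewrite ln_1, Rmult_0_r, exp_0; ring. }
fold (f z); rewrite <- H0.
apply Rabs_def2 in Hz.
destruct (MVT_gen f 0 z (fun _ => 0)) as (c & _ & Hc).
- intros x Hx; apply D; revert Hx; unfold Rmin, Rmax.
  destruct (Rle_dec 0 z); intros Hx; apply Rabs_def1; lra.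
- intros x Hx; apply continuity_pt_filterlim, @ex_derive_continuous.
  exists 0; apply D; revert Hx; unfold Rmin, Rmax.
  destruct (Rle_dec 0 z); intros Hx; apply Rabs_def1; lra.
- lra.
Qed.

Lemma series_tail_le (u v : nat -> R) l L : is_series u l -> is_series v L ->
  (forall k, Rabs (u k) <= v k) ->
  forall n, Rabs (l - sum_n u n) <= L - sum_n v n.
Proof.
intros Hu Hv Huv n.
assert (H : forall p, Rabs (sum_n u (p + n) - sum_n u n) <= sum_n v (p + n) - sum_n v n).
{ induction p as [|p IH].
  - simpl; rewrite !Rminus_diag, Rabs_R0; lra.
  - change (S p + n)%nat with (S (p + n)); rewrite !sum_Sn; unfold plus; simpl.
    replace (sum_n u (p + n) + u (S (p + n)) - sum_n u n)
      with ((sum_n u (p + n) - sum_n u n) + u (S (p + n))) by ring.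
    generalize (Rabs_triang (sum_n u (p + n) - sum_n u n) (u (S (p + n))))
      (Huv (S (p + n))); lra. }
assert (Hu' : is_lim_seq (fun p => sum_n u (p + n)) l)
  by (now apply (is_lim_seq_incr_n (sum_n u))).
assert (Hv' : is_lim_seq (fun p => sum_n v (p + n)) L)
  by (now apply (is_lim_seq_incr_n (sum_n v))).
apply (is_lim_seq_le _ _ (Rabs (l - sum_n u n)) (L - sum_n v n) H).
- apply (is_lim_seq_abs _ (Finite (l - sum_n u n))).
  now apply is_lim_seq_minus'; [|apply is_lim_seq_const].
- now apply is_lim_seq_minus'; [|apply is_lim_seq_const].
Qed.

Lemma continuous_bounded (f : R -> R) :
  (forall t, 0 <= t <= 1 -> continuous f t) ->
  exists M, 0 < M /\ forall t, 0 <= t <= 1 -> Rabs (f t) <= M.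
Proof.
intros Hf.
destruct (continuity_ab_maj (fun t => Rabs (f t)) 0 1) as (x & Hx & _); [lra| |].
- intros t Ht; apply continuity_pt_filterlim.
  apply continuous_comp with (g := Rabs); [now apply Hf|apply continuous_Rabs].
- exists (Rabs (f x) + 1); split; [generalize (Rabs_pos (f x)); lra|].
  intros t Ht; specialize (Hx t Ht); lra.
Qed.

Lemma continuous_pow (f : R -> R) n t :
  continuous f t -> continuous (fun x => f x ^ n) t.
Proof.
intros Hf; apply continuous_comp with (g := fun y => y ^ n); trivial.
apply @ex_derive_continuous; auto_derive; trivial.
Qed.

(** Since |y| K < 1, the tails of the binomial series are bounded uniformly in [t] by those of a
    convergent series. This serves both for the Gauss series at 0 and for the expansion about any
    other point. *)
Lemma RInt_binomial_series q (G k : R -> R) K y : 0 < K ->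
  (forall t, 0 <= t <= 1 -> continuous G t) ->
  (forall t, 0 <= t <= 1 -> continuous k t) ->
  (forall t, 0 <= t <= 1 -> 0 <= k t <= K) ->
  Rabs y * K < 1 ->
  is_pseries (fun n => bin q n * RInt (fun t => G t * k t ^ n) 0 1) y
    (RInt (fun t => G t * Rpower (1 - y * k t) (- q)) 0 1).
Proof.
intros HK HG Hk Hk1 Hy; apply is_pseries_R.
destruct (continuous_bounded G HG) as (M & HM0 & HM).
set (rho := Rabs y * K) in *.
assert (Hrho : 0 <= rho) by (apply Rmult_le_pos; [apply Rabs_pos|lra]).
assert (Hrho' : Rabs rho < 1) by (now rewrite Rabs_pos_eq).
assert (Hz : forall t, 0 <= t <= 1 -> Rabs (y * k t) <= rho).
{ intros t Ht; specialize (Hk1 t Ht); rewrite Rabs_mult, (Rabs_pos_eq (k t)) by lra.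
  apply Rmult_le_compat_l; [apply Rabs_pos|lra]. }
assert (Hv : is_series (fun n => Rabs (bin q n * rho ^ n))
  (Series (fun n => Rabs (bin q n * rho ^ n)))).
{ apply Series_correct; now apply CV_disk_bin. }
set (L := Series _) in Hv.
set (v := fun n => Rabs (bin q n * rho ^ n)) in Hv.
eapply is_series_ext; [|eapply is_series_RInt with
  (f := fun n t => bin q n * y ^ n * (G t * k t ^ n))
  (d := fun n t => M * (L - sum_n v n))].
- intros n; simpl.
  change ((fun a b : R => a = b)
    (RInt (fun t => scal (bin q n * y ^ n) (G t * k t ^ n)) 0 1)
    (bin q n * RInt (fun t => G t * k t ^ n) 0 1 * y ^ n)); simpl.
  rewrite (RInt_scal (V := R_CompleteNormedModule)).
  + unfold scal; simpl; unfold mult; simpl; ring.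
  + apply ex_RInt_01; intros; apply @continuous_mult; auto.
    now apply continuous_pow, Hk.
- intros n t Ht; apply @continuous_mult; [apply continuous_const|].
  apply @continuous_mult; auto; now apply continuous_pow, Hk.
- intros t Ht; apply @continuous_mult; auto; apply continuous_Rpower.
  + apply @continuous_minus; [apply continuous_const|].
    apply @continuous_mult; [apply continuous_const|auto].
  + specialize (Hz t Ht); apply Rabs_le_between in Hz; lra.
- intros; apply continuous_const.
- intros n t Ht.
  assert (Hzt : Rabs (y * k t) < 1) by (specialize (Hz t Ht); lra).
  generalize (binomial_series q (y * k t) Hzt); intros Hb.
  apply is_pseries_R in Hb.
  replace (sum_n (fun j => bin q j * y ^ j * (G t * k t ^ j)) n)
    with (G t * sum_n (fun j => bin q j * (y * k t) ^ j) n).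
  2:{ rewrite <- (sum_n_mult_l (K := R_Ring)); apply sum_n_ext; intros j.
      rewrite Rpow_mult_distr; unfold mult; simpl; ring. }
  rewrite <- Rmult_minus_distr_l, Rabs_mult.
  apply Rmult_le_compat; try apply Rabs_pos; [now apply HM|].
  apply series_tail_le with (1 := Hb) (2 := Hv).
  intros j; unfold v; rewrite !Rabs_mult; apply Rmult_le_compat_l; [apply Rabs_pos|].
  rewrite <- !RPow_abs, (Rabs_pos_eq rho) by trivial.
  apply pow_incr; split; [apply Rabs_pos|now apply Hz].
- apply is_lim_seq_ext with (fun n => M * (L - sum_n v n)).
  + intros n; rewrite RInt_const; unfold scal; simpl; unfold mult; simpl; ring.
  + replace (Finite 0) with (Finite (M * (L - L))) by (f_equal; ring).
    apply is_lim_seq_mult'; [apply is_lim_seq_const|].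
    now apply is_lim_seq_minus'; [apply is_lim_seq_const|].
Qed.

Section EulerIntegral.

Variables (q : R) (g h : R -> R).
Hypothesis g_cont : forall t, 0 <= t <= 1 -> continuous g t.
Hypothesis h_cont : forall t, 0 <= t <= 1 -> continuous h t.
Hypothesis h_unit : forall t, 0 <= t <= 1 -> 0 <= h t <= 1.

(** Euler's integral in a variable left open: [h] stands for the usual one, [g] for the weight
    together with the Jacobian. *)
Definition euler_integral (x : R) : R :=
  RInt (fun t => g t * Rpower (1 - x * h t) (- q)) 0 1.

Lemma euler_base_pos x t : x < 1 -> 0 <= t <= 1 -> 0 < 1 - x * h t.
Proof. intros Hx Ht; specialize (h_unit t Ht); destruct (Rle_lt_dec x 0); nra. Qed.

(** 1 - y h = (1 - x h)(1 - (y - x) h / (1 - x h)), and h / (1 - x h) <= 1 / (1 - x) for h in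
    [0, 1], so the binomial series in y - x converges within distance 1 - x. *)
Lemma euler_integral_analytic x : x < 1 -> analytic_at euler_integral x.
Proof.
intros Hx.
assert (Hr : 0 < 1 - x) by lra.
exists (fun n => bin q n * RInt (fun t =>
  g t * Rpower (1 - x * h t) (- q) * (h t / (1 - x * h t)) ^ n) 0 1), (mkposreal _ Hr).
intros y Hy; simpl in Hy.
assert (E : euler_integral y =
  RInt (fun t => g t * Rpower (1 - x * h t) (- q)
    * Rpower (1 - (y - x) * (h t / (1 - x * h t))) (- q)) 0 1).
{ apply RInt_ext; rewrite Rmin_left, Rmax_right by lra; intros t Ht.
  assert (Ht' : 0 <= t <= 1) by lra.
  assert (y < 1) by (apply Rabs_def2 in Hy; lra).
  generalize (euler_base_pos x t Hx Ht') (euler_base_pos y t H Ht'); intros P1 P2.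
  assert (E : 1 - (y - x) * (h t / (1 - x * h t)) = (1 - y * h t) / (1 - x * h t)).
  { field; lra. }
  rewrite E, Rmult_assoc, Rpower_mult_distr; trivial; [|now apply Rdiv_lt_0_compat].
  f_equal; f_equal; field; lra. }
assert (C : forall t, 0 <= t <= 1 -> continuous (fun t => 1 - x * h t) t).
{ intros t Ht; apply @continuous_minus; [apply continuous_const|].
  apply @continuous_mult; [apply continuous_const|auto]. }
rewrite E; apply RInt_binomial_series with (K := / (1 - x)).
- now apply Rinv_0_lt_compat.
- intros t Ht; apply @continuous_mult; auto; apply continuous_Rpower; auto.
  now apply euler_base_pos.
- intros t Ht; apply @continuous_mult; auto.
  apply continuous_comp with (g := Rinv); [auto|].
  apply continuous_Rinv; apply Rgt_not_eq; now apply euler_base_pos.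
- intros t Ht; generalize (euler_base_pos x t Hx Ht) (h_unit t Ht); intros P1 P2.
  split; [apply Rdiv_le_0_compat; lra|].
  apply Rmult_le_reg_r with (1 - x * h t); trivial.
  apply Rmult_le_reg_r with (1 - x); trivial.
  replace (h t / (1 - x * h t) * (1 - x * h t) * (1 - x)) with (h t * (1 - x)) by (field; lra).
  replace (/ (1 - x) * (1 - x * h t) * (1 - x)) with (1 - x * h t) by (field; lra).
  nra.
- apply Rmult_lt_reg_r with (1 - x); trivial.
  rewrite Rmult_assoc, Rinv_l by lra; lra.
Qed.

Lemma euler_integral_pseries x : Rabs x < 1 ->
  is_pseries (fun n => bin q n * RInt (fun t => g t * h t ^ n) 0 1) x (euler_integral x).
Proof. intros Hx; apply RInt_binomial_series with (K := 1); trivial; lra. Qed.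

End EulerIntegral.

(** Continuity at 0 kills the constant term, and division by [z] shifts the rest. Only positive [z]
    are used because [is_hyp2F1_unique] knows agreement on one side only. *)
Lemma is_pseries_zero_coef (d : nat -> R) r : 0 < r ->
  (forall z, 0 < z < r -> is_pseries d z 0) -> forall n, d n = 0.
Proof.
intros Hr Hd n; revert d Hd; induction n as [|n IH]; intros d Hd.
all: assert (H0 : d 0%nat = 0).
1, 3: destruct (Req_dec (d 0%nat) 0) as [|Hd0]; [trivial|exfalso].
1, 2: assert (HR : Rbar_lt 0 (CV_radius d)).
1, 3: (apply Rbar_lt_le_trans with (Finite (r / 2)); [simpl; lra|];
  rewrite <- (Rabs_pos_eq (r / 2)) by lra;
  apply Rbar_not_lt_le; intros Hlt; apply (CV_disk_outside d (r / 2) Hlt);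
  apply ex_series_lim_0; exists 0; apply is_pseries_R, Hd; lra).
1, 2: (assert (HC : continuous (PSeries d) 0) by
    (apply continuity_pt_filterlim, PSeries_continuity; now rewrite Rabs_R0);
  destruct (proj1 (filterlim_locally _ _) HC (mkposreal _ (Rabs_pos_lt _ Hd0))) as (e & He);
  set (z := Rmin e r / 2);
  assert (Hz : 0 < z < r /\ z < e) by
    (generalize (Rmin_l e r) (Rmin_r e r) (Rmin_glb_lt e r 0 (cond_pos e) Hr);
     unfold z; lra);
  specialize (He z); rewrite PSeries_0, (is_pseries_unique d z 0) in He by (apply Hd; lra);
  assert (Hb : ball 0 e z) by
    (change (Rabs (z - 0) < e); rewrite Rminus_0_r, Rabs_pos_eq; lra);
  specialize (He Hb); change (Rabs (0 - d 0%nat) < Rabs (d 0%nat)) in He;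
  rewrite Rminus_0_l, Rabs_Ropp in He; lra).
- trivial.
- apply (IH (fun k => d (S k))); intros z Hz.
  replace 0 with (scal (/ z) (plus 0 (opp (d 0%nat)))).
  + apply (is_pseries_decr_1 d z (/ z)); [|now apply Hd].
    unfold mult; simpl; apply Rinv_l; lra.
  + rewrite H0; unfold scal, plus, opp; simpl; unfold mult; simpl; ring.
Qed.

(** The identity theorem on a half-line: at the supremum [c] of the points of disagreement the two
    expansions agree to the right, hence have equal coefficients, hence agree to the left as
    well. *)
Lemma is_hyp2F1_unique A B C F G x :
  is_hyp2F1 A B C F -> is_hyp2F1 A B C G -> x < 1 -> F x = G x.
Proof.
intros [F0 FA] [G0 GA] Hx.
assert (Hnear : forall y, Rabs y < 1 -> F y = G y).
{ intros y Hy; rewrite <- (is_pseries_unique _ _ _ (F0 y Hy)).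
  apply is_pseries_unique, G0, Hy. }
destruct (Req_dec (F x) (G x)) as [|Hne]; [trivial|exfalso].
assert (Hx1 : x <= -1).
{ destruct (Rle_lt_dec x (-1)) as [|Hlt]; [trivial|exfalso].
  apply Hne, Hnear, Rabs_def1; lra. }
set (E := fun y => y < 1 /\ F y <> G y).
assert (HE : forall y, E y -> y <= -1).
{ intros y [Hy1 Hy]; destruct (Rle_lt_dec y (-1)) as [|Hlt]; [trivial|exfalso].
  apply Hy, Hnear, Rabs_def1; lra. }
destruct (completeness E) as (c & Hc1 & Hc2).
{ now exists (-1). }
{ now exists x. }
assert (Hc : c <= -1) by now apply Hc2.
destruct (FA c) as (u & r1 & Hu); [lra|].
destruct (GA c) as (v & r2 & Hv); [lra|].
set (r := Rmin (Rmin r1 r2) 1).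
assert (Hr : 0 < r /\ r <= r1 /\ r <= r2 /\ r <= 1).
{ generalize (cond_pos r1) (cond_pos r2); intros P1 P2; unfold r; repeat split.
  - apply Rmin_glb_lt; [now apply Rmin_glb_lt|lra].
  - eapply Rle_trans; [apply Rmin_l|apply Rmin_l].
  - eapply Rle_trans; [apply Rmin_l|apply Rmin_r].
  - apply Rmin_r. }
assert (Hdiff : forall y, Rabs (y - c) < r ->
  is_pseries (PS_minus u v) (y - c) (F y - G y)).
{ intros y Hy; apply (is_pseries_minus u v); [apply Hu|apply Hv]; lra. }
assert (Hz : forall n, PS_minus u v n = 0).
{ apply is_pseries_zero_coef with r; [lra|]; intros z Hz.
  replace z with (c + z - c) by ring.
  replace 0 with (F (c + z) - G (c + z)).
  - apply Hdiff; apply Rabs_def1; lra.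
  - apply Rminus_diag_eq; destruct (Req_dec (F (c + z)) (G (c + z))) as [|Hn]; trivial.
    exfalso; assert (c + z <= c); [|lra].
    apply Hc1; split; [lra|trivial]. }
assert (Heq : forall y, Rabs (y - c) < r -> F y = G y).
{ intros y Hy; apply Rminus_diag_uniq.
  rewrite <- (is_pseries_unique _ _ _ (Hdiff y Hy)).
  rewrite (PSeries_ext _ (fun _ => 0)) by trivial.
  unfold PSeries; rewrite (Series_ext _ (fun _ => 0 * 0)) by (intros; ring).
  rewrite Series_scal_l; ring. }
assert (c <= c - r); [|lra].
apply Hc2; intros y Hy.
destruct (Rle_lt_dec y (c - r)) as [|Hlt]; trivial; exfalso.
apply (proj2 Hy), Heq; specialize (Hc1 y Hy); apply Rabs_def1; lra.
Qed.

Lemma pochhammer_shift v n : pochhammer (v + 1) n * v = pochhammer v n * (v + INR n).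
Proof.
induction n as [|n IH]; [simpl; ring|].
simpl pochhammer; rewrite S_INR.
transitivity (pochhammer (v + 1) n * v * (v + 1 + INR n)); [ring|].
rewrite IH; ring.
Qed.

Lemma pochhammer_gt0 v n : 0 < v -> 0 < pochhammer v n.
Proof.
intros Hv; induction n as [|n IH]; simpl; [lra|].
generalize (pos_INR n); intros; apply Rmult_lt_0_compat; lra.
Qed.

(** The quotient of [pochhammer v n] by [pochhammer (v + 1) n] collapses to v / (v + n), which is v
    times the integral of t^(v + n - 1) over [0, 1]: these are the moments in Euler's integral. *)
Lemma hyp2F1_coef_shift q v n : 0 < v ->
  hyp2F1_coef q v (v + 1) n = bin q n * (v / (v + INR n)).
Proof.
intros Hv; unfold hyp2F1_coef, bin.
generalize (pos_INR n) (INR_fact_neq_0 n); intros Hn Hf.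
assert (P : 0 < pochhammer (v + 1) n) by (apply pochhammer_gt0; lra).
replace (pochhammer v n) with (pochhammer (v + 1) n * v / (v + INR n)).
- field; repeat split; trivial; lra.
- rewrite pochhammer_shift; field; lra.
Qed.

(* Euler's integral after the substitution [t = w^tau], which turns the weight
   [t^(v-1)] into [w^beta] with [v = (beta + 1) / tau]. *)
Lemma hyp2F1_euler q beta tau x : 0 <= beta -> 0 < tau -> x < 1 ->
  hyp2F1 q ((beta + 1) / tau) ((beta + 1) / tau + 1) x =
  (beta + 1) * RInt (fun w => pw w beta * Rpower (1 - x * pw w tau) (- q)) 0 1.
Proof.
intros Hb Ht Hx; set (v := (beta + 1) / tau).
assert (Hv : 0 < v) by (apply Rdiv_lt_0_compat; lra).
set (g := fun w => (beta + 1) * pw w beta).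
set (h := fun w => pw w tau).
assert (Cg : forall w, 0 <= w <= 1 -> continuous g w).
{ intros w _; apply @continuous_mult; [apply continuous_const|now apply continuous_pw]. }
assert (Ch : forall w, 0 <= w <= 1 -> continuous h w).
{ intros w _; apply continuous_pw; lra. }
assert (Hh : forall w, 0 <= w <= 1 -> 0 <= h w <= 1).
{ intros w Hw; split; [apply pw_ge0|apply pw_le1; lra]. }
assert (H : is_hyp2F1 q v (v + 1) (euler_integral q g h)).
{ split.
  - intros y Hy; eapply is_pseries_ext; [|apply euler_integral_pseries; eassumption].
    intros n; simpl; rewrite hyp2F1_coef_shift by trivial; f_equal.
    generalize (pos_INR n); intros Hn.
    assert (Htn : 0 <= tau * INR n) by (apply Rmult_le_pos; lra).
    rewrite (RInt_ext _ (fun w => scal (beta + 1) (pw w (beta + tau * INR n)))).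
    + rewrite (RInt_scal (V := R_CompleteNormedModule)), RInt_pw.
      * unfold scal; simpl; unfold mult; simpl; unfold v; field; repeat split; nra.
      * lra.
      * apply ex_RInt_01; intros; apply continuous_pw; lra.
    + intros w _; unfold g, h; rewrite pw_pow, pw_plus by lra.
      unfold scal; simpl; unfold mult; simpl; ring.
  - intros y Hy; now apply euler_integral_analytic. }
transitivity (euler_integral q g h x).
(* The choice operator returns a function with the specified property because Euler's integral is
   one. *)
- apply (is_hyp2F1_unique q v (v + 1)); trivial.
  unfold hyp2F1; apply epsilon_spec; now exists (euler_integral q g h).
- unfold euler_integral, g, h.
  transitivity (RInt (fun w =>
    scal (beta + 1) (pw w beta * Rpower (1 - x * pw w tau) (- q))) 0 1).
  + apply RInt_ext; intros w _; unfold scal; simpl; unfold mult; simpl; ring.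
  + apply (RInt_scal (V := R_CompleteNormedModule)), ex_RInt_01; intros w Hw.
    apply @continuous_mult; [now apply continuous_pw|].
    apply continuous_Rpower.
    * apply @continuous_minus; [apply continuous_const|].
      apply @continuous_mult; [apply continuous_const|apply continuous_pw; lra].
    * now apply (euler_base_pos h Hh).
Qed.

(** * Expansion of the integrals of the theorem *)

Lemma is_derive_n_Rpower q k t : -1 < t ->
  is_derive_n (fun x => Rpower (1 + x) (- q)) k t
    ((-1) ^ k * pochhammer q k * Rpower (1 + t) (- q - INR k)).
Proof.
revert t; induction k as [|k IH]; intros t Ht.
- simpl; rewrite Rminus_0_r; ring.
- change (is_derive (Derive_n (fun x => Rpower (1 + x) (- q)) k) t
    ((-1) ^ S k * pochhammer q (S k) * Rpower (1 + t) (- q - INR (S k)))).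
  apply is_derive_ext_loc with
    (fun x => (-1) ^ k * pochhammer q k * Rpower (1 + x) (- q - INR k)).
  + assert (Ht' : 0 < t + 1) by lra; exists (mkposreal _ Ht'); intros x Hx.
    symmetry; apply is_derive_n_unique, IH.
    apply Rabs_lt_between' in Hx; simpl in Hx; lra.
  + replace ((-1) ^ S k * pochhammer q (S k) * Rpower (1 + t) (- q - INR (S k)))
      with ((-1) ^ k * pochhammer q k *
        (1 * ((- q - INR k) * Rpower (1 + t) (- q - INR k - 1)))).
    * apply is_derive_scal, (is_derive_Rpower_comp (fun x => 1 + x)); [|lra].
      auto_derive; trivial; ring.
    * rewrite S_INR; simpl; replace (- q - (INR k + 1)) with (- q - INR k - 1) by ring.
      ring.
Qed.

Lemma Rpower_le1 x p : 1 <= x -> p <= 0 -> Rpower x p <= 1.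
Proof.
intros Hx Hp; rewrite <- (Rpower_O x) by lra; now apply Rle_Rpower.
Qed.

(** In Lagrange's remainder the factor (1 + xi)^(-q-n-1) is at most 1, as q >= -1 makes its exponent
    nonpositive. Unlike [binomial_series], this reaches z = 1. *)
Lemma binomial_remainder q z n : -1 <= q -> 0 <= z ->
  Rabs (Rpower (1 + z) (- q) - sum_n (fun k => (-1) ^ k * bin q k * z ^ k) n)
  <= Rabs (bin q (S n)) * z ^ S n.
Proof.
intros Hq [Hz|<-].
2:{ replace (sum_n _ n) with 1.
    - rewrite Rplus_0_r; unfold Rpower; rewrite ln_1, Rmult_0_r, exp_0.
      rewrite Rminus_diag, Rabs_R0; simpl; lra.
    - induction n as [|n IH]; [rewrite sum_O, bin_O; simpl; ring|].
      rewrite sum_Sn, <- IH; unfold plus; simpl; ring. }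
destruct (Taylor_Lagrange (fun x => Rpower (1 + x) (- q)) n 0 z Hz) as (xi & Hxi & E).
{ intros t Ht [|k] _; simpl; trivial.
  exists ((-1) ^ S k * pochhammer q (S k) * Rpower (1 + t) (- q - INR (S k))).
  apply (is_derive_n_Rpower q (S k)); lra. }
rewrite E, <- sum_n_Reals; clear E.
rewrite (sum_n_ext _ (fun k => (-1) ^ k * bin q k * z ^ k)).
2:{ intros k; simpl; rewrite (is_derive_n_unique _ _ _ _ (is_derive_n_Rpower q k 0 ltac:(lra))).
    rewrite Rplus_0_r, Rminus_0_r; unfold Rpower; rewrite ln_1, Rmult_0_r, exp_0.
    eq_R; unfold bin; field; apply INR_fact_neq_0. }
rewrite Rplus_comm; unfold Rminus; rewrite Rplus_assoc, Rplus_opp_r, Rplus_0_r, Ropp_0, Rplus_0_r.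
rewrite (is_derive_n_unique _ _ _ _ (is_derive_n_Rpower q (S n) xi ltac:(lra))).
replace (z ^ S n / INR (fact (S n)) *
    ((-1) ^ S n * pochhammer q (S n) * Rpower (1 + xi) (- q - INR (S n))))
  with ((-1) ^ S n * (bin q (S n) * z ^ S n * Rpower (1 + xi) (- q - INR (S n))))
  by (unfold bin; field; apply INR_fact_neq_0).
rewrite Rabs_mult, pow_1_abs, Rmult_1_l, !Rabs_mult.
rewrite (Rabs_pos_eq (Rpower _ _)) by (left; apply exp_pos).
rewrite (Rabs_pos_eq (z ^ S n)) by (apply pow_le; lra).
rewrite <- (Rmult_1_r (_ * z ^ S n)) at 2.
apply Rmult_le_compat_l.
- apply Rmult_le_pos; [apply Rabs_pos|apply pow_le; lra].
- apply Rpower_le1; [lra|]; rewrite S_INR; generalize (pos_INR n); lra.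
Qed.

(* If [bin p] decreased to [l > 0], then [l / (1 - z) <= (1 - z)^(-p)] for
   [0 < z < 1], which fails as [z -> 1]. *)
Lemma is_lim_seq_bin p : 0 < p < 1 -> is_lim_seq (bin p) 0.
Proof.
intros Hp.
assert (Hpos : forall n, 0 <= bin p n) by (intros n; left; apply bin_gt0; lra).
assert (Hdec : forall n, bin p (S n) <= bin p n).
{ intros n; rewrite bin_S; generalize (Hpos n) (pos_INR n); intros H1 H2.
  rewrite <- Rmult_1_r; apply Rmult_le_compat_l; trivial.
  apply Rmult_le_reg_r with (INR n + 1); [lra|].
  unfold Rdiv; rewrite Rmult_assoc, Rinv_l; lra. }
destruct (ex_finite_lim_seq_decr (bin p) 0 Hdec Hpos) as (l & Hl).
assert (Hlb : forall n, l <= bin p n).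
{ intros n; now apply (is_lim_seq_decr_compare (bin p)). }
assert (Hl0 : 0 <= l) by exact (is_lim_seq_le _ _ 0 l Hpos (is_lim_seq_const 0) Hl).
destruct (Req_dec l 0) as [->|Hne]; [trivial|exfalso].
assert (Hl1 : l <= 1) by (rewrite <- (bin_O p); apply Hlb).
(* Chosen so that d^(1 - p) = l / 2, whereas the comparison at z = 1 - d forces l <= d^(1 - p). *)
set (d := Rpower (l / 2) (/ (1 - p))).
assert (Hd : 0 < d) by apply exp_pos.
assert (Hdp : Rpower d (1 - p) = l / 2).
{ unfold d; rewrite Rpower_mult, Rinv_l, Rpower_1; lra. }
assert (Hd1 : d < 1).
{ destruct (Rlt_le_dec d 1) as [|H]; trivial; exfalso.
  assert (Rpower 1 (1 - p) <= Rpower d (1 - p)) by (apply Rle_Rpower_l; lra).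
  assert (Rpower 1 (1 - p) = 1)
    by (unfold Rpower; now rewrite ln_1, Rmult_0_r, exp_0).
  lra. }
assert (Hz : Rabs (1 - d) < 1) by (apply Rabs_def1; lra).
assert (Hs : is_series (fun n => bin p n * (1 - d) ^ n) (Rpower d (- p))).
{ apply is_pseries_R; replace d with (1 - (1 - d)) at 2 by ring.
  now apply binomial_series. }
assert (Hg : is_series (fun n => l * (1 - d) ^ n) (l * / d)).
{ replace (/ d) with (/ (1 - (1 - d))) by (f_equal; ring).
  apply (is_series_scal_l l (fun n => (1 - d) ^ n)); now apply is_series_geom. }
assert (H : l * / d <= Rpower d (- p)).
{ rewrite <- (is_series_unique _ _ Hs), <- (is_series_unique _ _ Hg).
  apply Series_le; [|now exists (Rpower d (- p))].
  intros n; assert (0 <= (1 - d) ^ n) by (apply pow_le; lra); split.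
  - now apply Rmult_le_pos.
  - now apply Rmult_le_compat_r. }
assert (E : Rpower d (1 - p) = d * Rpower d (- p)).
{ unfold Rminus; now rewrite Rpower_plus, Rpower_1. }
apply Rmult_le_compat_l with (r := d) in H; [|lra].
replace (d * (l * / d)) with l in H by (field; lra).
lra.
Qed.

(** For |q| <= p + 1 with 0 < p < 1, the majorant bin (p + 1) n is bin p n times (p + n) / p; the
    denominator absorbs the linear factor, as p + n <= (p + 1/tau)(tau n + 1), and [bin p] tends to
    0. *)
Lemma is_lim_seq_bin_div q tau : Rabs q < 2 -> 0 < tau ->
  is_lim_seq (fun n => Rabs (bin q n) / (tau * INR n + 1)) 0.
Proof.
intros Hq Ht.
assert (Hmax : 1 <= Rmax 1 (Rabs q) < 2 /\ Rabs q <= Rmax 1 (Rabs q)).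
{ repeat split; [apply Rmax_l|apply Rmax_lub_lt; lra|apply Rmax_r]. }
(* Midway between max(1, |q|) and 2, so that [p] lies strictly between 0 and 1. *)
set (m := (Rmax 1 (Rabs q) + 2) / 2); set (p := m - 1).
assert (Hp : 0 < p < 1 /\ Rabs q <= p + 1) by (unfold p, m; lra).
apply is_lim_seq_le_le with (u := fun _ => 0)
  (w := fun n => (p + / tau) / p * bin p n).
- intros n; generalize (pos_INR n); intros Hn.
  assert (Htn : 0 < tau * INR n + 1) by nra.
  split; [apply Rdiv_le_0_compat; [apply Rabs_pos|trivial]|].
  apply Rmult_le_reg_r with (tau * INR n + 1); trivial.
  unfold Rdiv at 1; rewrite Rmult_assoc, Rinv_l, Rmult_1_r by lra.
  apply Rle_trans with (bin (p + 1) n); [now apply bin_le|].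
  assert (E : bin (p + 1) n = bin p n * ((p + INR n) / p)).
  { unfold bin; generalize (pochhammer_shift p n) (INR_fact_neq_0 n); intros H1 H2.
    replace (pochhammer (p + 1) n) with (pochhammer p n * (p + INR n) / p).
    - field; lra.
    - rewrite <- H1; field; lra. }
  rewrite E.
  replace ((p + / tau) / p * bin p n * (tau * INR n + 1))
    with (bin p n * (((p + / tau) * (tau * INR n + 1)) / p)) by (field; lra).
  apply Rmult_le_compat_l; [left; apply bin_gt0; lra|].
  apply Rmult_le_compat_r; [left; apply Rinv_0_lt_compat; lra|].
  replace ((p + / tau) * (tau * INR n + 1))
    with (p + INR n + (p * (tau * INR n) + / tau)) by (field; lra).
  assert (0 < / tau) by (now apply Rinv_0_lt_compat).
  assert (0 <= p * (tau * INR n)) by (apply Rmult_le_pos; nra).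
  lra.
- apply is_lim_seq_const.
- replace (Finite 0) with (Finite ((p + / tau) / p * 0)) by (f_equal; ring).
  apply is_lim_seq_mult'; [apply is_lim_seq_const|apply is_lim_seq_bin; lra].
Qed.

(** The assumed limit is that of the integrated Lagrange bounds, up to a bound on [W]. It comes from
    |q| < 2 when c <= 1, and from geometric decay when c < 1. *)
Lemma RInt_weighted_binomial_series q c tau (W : R -> R) :
  -1 <= q -> 0 <= c -> 0 < tau ->
  (forall t, 0 <= t <= 1 -> continuous W t) ->
  is_lim_seq (fun n => Rabs (bin q n) * c ^ n / (tau * INR n + 1)) 0 ->
  is_series (fun k => (-1) ^ k * bin q k * c ^ k
               * RInt (fun w => pw w (tau * INR k) * W w) 0 1)
    (RInt (fun w => Rpower (1 + c * pw w tau) (- q) * W w) 0 1).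
Proof.
intros Hq Hc Ht HW Hlim.
destruct (continuous_bounded W HW) as (M & HM0 & HM).
assert (Htn : forall n, 0 <= tau * INR n).
{ intros n; generalize (pos_INR n); nra. }
eapply is_series_ext; [|eapply is_series_RInt with
  (f := fun n w => (-1) ^ n * bin q n * c ^ n * (pw w (tau * INR n) * W w))
  (d := fun n w => M * (Rabs (bin q (S n)) * c ^ S n) * pw w (tau * INR (S n)))].
- intros n; apply (RInt_scal (V := R_CompleteNormedModule)
    (fun w => pw w (tau * INR n) * W w) 0 1 ((-1) ^ n * bin q n * c ^ n)).
  apply ex_RInt_01; intros; apply @continuous_mult; auto.
  now apply continuous_pw.
- intros n t Ht'; apply @continuous_mult; [apply continuous_const|].
  apply @continuous_mult; auto; now apply continuous_pw.
- intros t Ht'; apply @continuous_mult; auto.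
  apply continuous_Rpower.
  + apply @continuous_plus; [apply continuous_const|].
    apply @continuous_mult; [apply continuous_const|apply continuous_pw; lra].
  + generalize (pw_ge0 t tau); intros; nra.
- intros n t _; apply @continuous_mult; [apply continuous_const|now apply continuous_pw].
- intros n t Ht'.
  assert (Hz : 0 <= c * pw t tau) by (apply Rmult_le_pos; [trivial|apply pw_ge0]).
  replace (sum_n _ n)
    with (W t * sum_n (fun k => (-1) ^ k * bin q k * (c * pw t tau) ^ k) n).
  2:{ rewrite <- (sum_n_mult_l (K := R_Ring)); apply sum_n_ext; intros j.
      rewrite Rpow_mult_distr, pw_pow by lra; unfold mult; simpl; ring. }
  rewrite (Rmult_comm (Rpower _ _)), <- Rmult_minus_distr_l, Rabs_mult, !Rmult_assoc.
  apply Rmult_le_compat; try apply Rabs_pos; [now apply HM|].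
  eapply Rle_trans; [now apply binomial_remainder|].
  rewrite Rpow_mult_distr, pw_pow by lra; lra.
- apply is_lim_seq_ext with
    (fun n => M * (Rabs (bin q (S n)) * c ^ S n / (tau * INR (S n) + 1))).
  + intros n.
    transitivity (M * (Rabs (bin q (S n)) * c ^ S n)
      * RInt (fun w => pw w (tau * INR (S n))) 0 1).
    * rewrite RInt_pw by trivial; unfold Rdiv; ring.
    * symmetry; apply (RInt_scal (V := R_CompleteNormedModule)
        (fun w => pw w (tau * INR (S n))) 0 1 (M * (Rabs (bin q (S n)) * c ^ S n))).
      apply ex_RInt_01; intros; now apply continuous_pw.
  + replace (Finite 0) with (Finite (M * 0)) by (f_equal; ring).
    apply is_lim_seq_mult'; [apply is_lim_seq_const|].
    now apply (is_lim_seq_incr_1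
      (fun n => Rabs (bin q n) * c ^ n / (tau * INR n + 1))).
Qed.

(** * Integrals of two binomial factors: convergent and Abel-regularized series *)

Definition lame_factor (q c tau w : R) : R := Rpower (1 + c * pw w tau) (- q).

Definition lame_integral (q1 c1 tau1 q2 c2 tau2 : R) : R :=
  RInt (fun w => lame_factor q1 c1 tau1 w * lame_factor q2 c2 tau2 w) 0 1.

Lemma lame_integral_sym q1 c1 tau1 q2 c2 tau2 :
  lame_integral q1 c1 tau1 q2 c2 tau2 = lame_integral q2 c2 tau2 q1 c1 tau1.
Proof. apply RInt_ext; intros; apply Rmult_comm. Qed.

Lemma continuous_lame_factor q c tau w : 0 <= c -> 0 <= tau ->
  continuous (lame_factor q c tau) w.
Proof.
intros Hc Ht; apply continuous_Rpower.
- apply @continuous_plus; [apply continuous_const|].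
  apply @continuous_mult; [apply continuous_const|now apply continuous_pw].
- generalize (pw_ge0 w tau); intros; nra.
Qed.

(** Index 1 marks the factor expanded into a series, index 2 the factor kept inside the
    hypergeometric function. *)
Definition lame_term (q1 c1 q2 c2 : R) (u : nat -> R) (k : nat) : R :=
  (-1) ^ k * bin q1 k * c1 ^ k * (1 / u k) * hyp2F1 q2 (u k) (u k + 1) (- c2).

Section LameSeries.

Variables (q1 tau1 q2 c2 tau2 : R) (u : nat -> R).
Hypothesis hq1 : -1 <= q1.
Hypothesis htau1 : 0 < tau1.
Hypothesis htau2 : 0 < tau2.
Hypothesis hc2 : 0 <= c2.
Hypothesis hu : forall k, u k = (tau1 * INR k + 1) / tau2.

(** Integrating w^(tau1 k) against the second factor gives Euler's integral with beta = tau1 k; its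
    normalisation beta + 1 is tau2 u_k, which leaves the constant [tau2]. *)
Lemma is_series_lame c1 : 0 <= c1 ->
  is_lim_seq (fun n => Rabs (bin q1 n) * c1 ^ n / (tau1 * INR n + 1)) 0 ->
  is_series (lame_term q1 c1 q2 c2 u)
    (tau2 * lame_integral q1 c1 tau1 q2 c2 tau2).
Proof.
intros Hc Hlim.
generalize (RInt_weighted_binomial_series q1 c1 tau1 (lame_factor q2 c2 tau2)
  hq1 Hc htau1 (fun t _ => continuous_lame_factor q2 c2 tau2 t hc2 (Rlt_le _ _ htau2))
  Hlim); intros H.
apply (is_series_scal_l tau2) in H.
eapply is_series_ext; [|exact H].
intros k; unfold lame_term; rewrite hu.
assert (Hk : 0 <= tau1 * INR k) by (generalize (pos_INR k); nra).
rewrite hyp2F1_euler by (trivial; lra).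
rewrite (RInt_ext (fun w => pw w (tau1 * INR k) * Rpower (1 - - c2 * pw w tau2) (- q2))
  (fun w => pw w (tau1 * INR k) * lame_factor q2 c2 tau2 w)).
- unfold scal; simpl; unfold mult; simpl; field; lra.
- intros w _; unfold lame_factor; do 2 f_equal; ring.
Qed.

Lemma is_series_lame_conv c1 : 0 <= c1 <= 1 -> Rabs q1 < 2 ->
  is_series (lame_term q1 c1 q2 c2 u)
    (tau2 * lame_integral q1 c1 tau1 q2 c2 tau2).
Proof.
intros Hc Hq; apply is_series_lame; [lra|].
apply is_lim_seq_le_le with (2 := is_lim_seq_const 0)
  (3 := is_lim_seq_bin_div q1 tau1 Hq htau1).
intros n; generalize (pos_INR n) (pow_le c1 n (proj1 Hc)) (Rabs_pos (bin q1 n));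
  intros H1 H2 H3.
assert (0 < / (tau1 * INR n + 1)) by (apply Rinv_0_lt_compat; nra).
assert (c1 ^ n <= 1) by (rewrite <- (pow1 n); now apply pow_incr).
split; [apply Rmult_le_pos; [now apply Rmult_le_pos|lra]|].
apply Rmult_le_compat_r; [lra|]; nra.
Qed.

(** The decay of c1^n beats the growth of [bin q1] for every [q1], which covers alpha > 2, that is s
    < 1. *)
Lemma is_series_lame_disk c1 : 0 <= c1 < 1 ->
  is_series (lame_term q1 c1 q2 c2 u)
    (tau2 * lame_integral q1 c1 tau1 q2 c2 tau2).
Proof.
intros Hc; apply is_series_lame; [lra|].
assert (Hlim : is_lim_seq (fun n => Rabs (bin q1 n * c1 ^ n)) 0).
{ apply ex_series_lim_0, CV_disk_bin; rewrite Rabs_pos_eq; lra. }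
apply is_lim_seq_le_le with (2 := is_lim_seq_const 0) (3 := Hlim).
intros n; rewrite Rabs_mult, (Rabs_pos_eq (c1 ^ n)) by (apply pow_le; lra).
generalize (pos_INR n) (pow_le c1 n (proj1 Hc)) (Rabs_pos (bin q1 n)); intros H1 H2 H3.
assert (H4 : 0 <= Rabs (bin q1 n) * c1 ^ n) by (now apply Rmult_le_pos).
assert (H5 : 1 <= tau1 * INR n + 1) by nra.
split; [apply Rdiv_le_0_compat; lra|].
apply Rmult_le_reg_r with (tau1 * INR n + 1); [lra|].
unfold Rdiv; rewrite Rmult_assoc, Rinv_l by lra; nra.
Qed.

(** The derivative in [y] of (1 + c p y)^(-q1) is at most |q1| in absolute value, because c p <= 1
    and the exponent -q1 - 1 is nonpositive; this bound is uniform in [w]. *)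
Lemma lame_factor_lipschitz c e w : 0 <= c <= 1 -> 0 < e < 1 -> 0 <= w <= 1 ->
  Rabs (lame_factor q1 (c * e) tau1 w - lame_factor q1 c tau1 w) <= Rabs q1 * (1 - e).
Proof.
intros Hc He Hw; unfold lame_factor; set (p := pw w tau1).
assert (Hp : 0 <= p <= 1) by (split; [apply pw_ge0|apply pw_le1; lra]).
assert (Hcp : 0 <= c * p <= 1) by (split; nra).
destruct (MVT_gen (fun y => Rpower (1 + c * p * y) (- q1)) 1 e
  (fun y => (c * p) * (- q1 * Rpower (1 + c * p * y) (- q1 - 1)))) as (x & Hx & E).
- intros x Hx; rewrite Rmin_right, Rmax_left in Hx by lra.
  apply (is_derive_Rpower_comp (fun y => 1 + c * p * y)); [|nra].
  auto_derive; trivial; ring.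
- intros x Hx; rewrite Rmin_right, Rmax_left in Hx by lra.
  apply continuity_pt_filterlim, (continuous_Rpower (fun y => 1 + c * p * y)); [|nra].
  apply @ex_derive_continuous; auto_derive; trivial.
- rewrite Rmin_right, Rmax_left in Hx by lra.
  replace (1 + c * e * p) with (1 + c * p * e) by ring.
  replace (1 + c * p) with (1 + c * p * 1) by ring.
  rewrite E.
  assert (HR : 0 <= Rpower (1 + c * p * x) (- q1 - 1) <= 1).
  { split; [left; apply exp_pos|apply Rpower_le1; [nra|lra]]. }
  rewrite !Rabs_mult, Rabs_Ropp, (Rabs_left (e - 1)) by lra.
  rewrite (Rabs_pos_eq (Rpower _ _)), <- Rabs_mult, (Rabs_pos_eq (c * p)) by lra.
  replace (- (e - 1)) with (1 - e) by ring; apply Rmult_le_compat_r; [lra|].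
  generalize (Rabs_pos q1); intros Hq.
  assert (0 <= Rabs q1 * Rpower (1 + c * p * x) (- q1 - 1) <= Rabs q1) by (split; nra).
  nra.
Qed.

Lemma lame_integral_left_cont c : 0 <= c <= 1 ->
  filterlim (fun e => lame_integral q1 (c * e) tau1 q2 c2 tau2) (at_left 1)
    (locally (lame_integral q1 c tau1 q2 c2 tau2)).
Proof.
intros Hc; apply filterlim_locally; intros eps.
destruct (continuous_bounded (lame_factor q2 c2 tau2)) as (M & HM0 & HM).
{ intros; apply continuous_lame_factor; lra. }
(* Adding 1 keeps [K] positive when [q1 = 0]. *)
set (K := (Rabs q1 + 1) * M).
assert (HK : 0 < K) by (unfold K; generalize (Rabs_pos q1); intros; nra).
assert (Hd : 0 < Rmin 1 (eps / K)).
{ apply Rmin_glb_lt; [lra|]; apply Rdiv_lt_0_compat; [apply cond_pos|trivial]. }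
exists (mkposreal _ Hd); intros e He He1.
apply Rabs_lt_between' in He; simpl in He.
generalize (Rmin_l 1 (eps / K)) (Rmin_r 1 (eps / K)); intros Hm1 Hm2.
assert (Ce : forall t, 0 <= t <= 1 -> continuous
  (fun w => lame_factor q1 (c * e) tau1 w * lame_factor q2 c2 tau2 w) t).
{ intros; apply @continuous_mult; apply continuous_lame_factor; nra. }
assert (C1 : forall t, 0 <= t <= 1 -> continuous
  (fun w => lame_factor q1 c tau1 w * lame_factor q2 c2 tau2 w) t).
{ intros; apply @continuous_mult; apply continuous_lame_factor; lra. }
change (Rabs (minus (lame_integral q1 (c * e) tau1 q2 c2 tau2)
  (lame_integral q1 c tau1 q2 c2 tau2)) < eps).
unfold lame_integral.
rewrite <- (RInt_minus (V := R_CompleteNormedModule)) by (now apply ex_RInt_01).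
apply Rle_lt_trans with ((1 - 0) * (K * (1 - e))).
- apply abs_RInt_le_const; [lra| |].
  + apply ex_RInt_01; intros; apply @continuous_minus; auto.
  + intros t Ht; unfold minus, plus, opp; simpl.
    replace (lame_factor q1 (c * e) tau1 t * lame_factor q2 c2 tau2 t
      + - (lame_factor q1 c tau1 t * lame_factor q2 c2 tau2 t))
      with ((lame_factor q1 (c * e) tau1 t - lame_factor q1 c tau1 t)
        * lame_factor q2 c2 tau2 t) by ring.
    rewrite Rabs_mult.
    replace (K * (1 - e)) with ((Rabs q1 + 1) * (1 - e) * M) by (unfold K; ring).
    apply Rmult_le_compat; try apply Rabs_pos; [|now apply HM].
    eapply Rle_trans; [apply lame_factor_lipschitz; trivial; lra|].
    apply Rmult_le_compat_r; lra.
- assert (1 - e < eps / K) by lra.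
  rewrite Rminus_0_r, Rmult_1_l; apply Rmult_lt_reg_l with (/ K).
  + now apply Rinv_0_lt_compat.
  + rewrite <- Rmult_assoc, Rinv_l by lra; unfold Rdiv in H; lra.
Qed.

(** The factor e^k merges with c1^k, so the regularized series is the convergent one with
    [c1 * e < 1] in place of [c1]. *)
Lemma is_abel_sum_lame c1 : 0 <= c1 <= 1 ->
  is_abel_sum (lame_term q1 c1 q2 c2 u)
    (tau2 * lame_integral q1 c1 tau1 q2 c2 tau2).
Proof.
intros Hc.
assert (H : forall e, 0 < e < 1 -> is_series (fun k => lame_term q1 c1 q2 c2 u k * e ^ k)
  (tau2 * lame_integral q1 (c1 * e) tau1 q2 c2 tau2)).
{ intros e He; eapply is_series_ext; [|apply is_series_lame_disk; split; nra].
  intros k; simpl; unfold lame_term; rewrite Rpow_mult_distr; eq_R; ring. }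
split.
- intros e He; eexists; now apply H.
- apply filterlim_ext_loc with
    (fun e => tau2 * lame_integral q1 (c1 * e) tau1 q2 c2 tau2).
  + exists (mkposreal 1 Rlt_0_1); intros e He He1.
    apply Rabs_lt_between' in He; simpl in He.
    symmetry; apply is_series_unique, H; lra.
  + apply filterlim_comp with (g := fun x => tau2 * x)
      (1 := lame_integral_left_cont c1 Hc).
    apply (filterlim_scal_r (V := R_NormedModule) tau2).
Qed.

End LameSeries.

(** * The octants of a superellipse *)

(* [x = a X] and [y = b Y] with [X^s = 1 / (1 + w^(kappa s))] and
   [Y / X = w^kappa]; both coordinates are [C^1] up to [w = 0] as soon as
   [kappa >= 1] and [kappa s >= 1]. *)
Section Octant.

Variables (a b s kappa : R).
Hypothesis ha : 0 < a.
Hypothesis hb : 0 < b.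
Hypothesis hs : 0 < s.
Hypothesis hk : 1 <= kappa.
Hypothesis hks : 1 <= kappa * s.

Let base w := 1 + pw w (kappa * s).
Let X w := Rpower (base w) (- (1 / s)).
Let xw w := a * X w.
Let yw w := b * (pw w kappa * X w).
Let xw' w := - (a * kappa * (pw w (kappa * s - 1) * Rpower (base w) (- alpha s))).
Let yw' w := b * kappa * (pw w (kappa - 1) * Rpower (base w) (- alpha s)).

Lemma base_ge1 w : 1 <= base w.
Proof. unfold base; generalize (pw_ge0 w (kappa * s)); lra. Qed.

Lemma base_cont w : continuous base w.
Proof.
apply @continuous_plus; [apply continuous_const|apply continuous_pw; lra].
Qed.

Lemma base_Rpower_cont p w : continuous (fun w => Rpower (base w) p) w.
Proof.
apply continuous_Rpower; [apply base_cont|generalize (base_ge1 w); lra].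
Qed.

Lemma xw_cont w : continuous xw w.
Proof. apply @continuous_mult; [apply continuous_const|apply base_Rpower_cont]. Qed.

Lemma yw_cont w : continuous yw w.
Proof.
apply @continuous_mult; [apply continuous_const|].
apply @continuous_mult; [apply continuous_pw; lra|apply base_Rpower_cont].
Qed.

Lemma xw'_cont w : continuous xw' w.
Proof.
apply @continuous_opp, @continuous_mult; [apply continuous_const|].
apply @continuous_mult; [apply continuous_pw; lra|apply base_Rpower_cont].
Qed.

Lemma yw'_cont w : continuous yw' w.
Proof.
apply @continuous_mult; [apply continuous_const|].
apply @continuous_mult; [apply continuous_pw; lra|apply base_Rpower_cont].
Qed.

Lemma X_deriv w : 0 < w ->
  is_derive X w (- (kappa * (pw w (kappa * s - 1) * Rpower (base w) (- alpha s)))).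
Proof.
intros Hw.
replace (- (kappa * (pw w (kappa * s - 1) * Rpower (base w) (- alpha s))))
  with ((0 + kappa * s * pw w (kappa * s - 1))
    * (- (1 / s) * Rpower (base w) (- (1 / s) - 1))).
- apply (is_derive_Rpower_comp base); [|generalize (base_ge1 w); lra].
  apply @is_derive_plus; [apply @is_derive_const|now apply is_derive_pw].
- unfold alpha; replace (- (1 / s) - 1) with (- (1 + 1 / s)) by ring; field; lra.
Qed.

Lemma xw_deriv w : 0 < w -> is_derive xw w (xw' w).
Proof.
intros Hw; unfold xw'.
replace (- (a * kappa * (pw w (kappa * s - 1) * Rpower (base w) (- alpha s))))
  with (a * - (kappa * (pw w (kappa * s - 1) * Rpower (base w) (- alpha s)))) by ring.
now apply is_derive_scal, X_deriv.
Qed.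

(** Since X = base * base^(-alpha), the product rule gives b kappa w^(kappa - 1) base^(-alpha) times
    base - w^(kappa s), and this difference is 1. *)
Lemma yw_deriv w : 0 < w -> is_derive yw w (yw' w).
Proof.
intros Hw; unfold yw'.
replace (b * kappa * (pw w (kappa - 1) * Rpower (base w) (- alpha s)))
  with (b * (kappa * pw w (kappa - 1) * X w +
    pw w kappa * - (kappa * (pw w (kappa * s - 1) * Rpower (base w) (- alpha s))))).
- apply is_derive_scal.
  apply (is_derive_mult (fun w => pw w kappa) X).
  + now apply is_derive_pw.
  + now apply X_deriv.
  + intros; apply Rmult_comm.
- replace (X w) with (base w * Rpower (base w) (- alpha s)).
  2:{ unfold X; rewrite <- (Rpower_1 (base w)) at 1
        by (generalize (base_ge1 w); lra).
      rewrite <- Rpower_plus; f_equal; unfold alpha; ring. }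
  set (Q := Rpower _ _).
  assert (E : pw w kappa * pw w (kappa * s - 1) = pw w (kappa - 1) * pw w (kappa * s)).
  { rewrite <- !pw_plus by lra; f_equal; ring. }
  unfold base.
  transitivity (b * kappa * Q * (pw w (kappa - 1) + pw w (kappa - 1) * pw w (kappa * s)
    - pw w kappa * pw w (kappa * s - 1))); [ring|rewrite E; ring].
Qed.

Lemma octant_curve_length :
  has_length (fun w => (xw w, yw w)) 0 1
    (RInt (fun w => sqrt ((xw' w)² + (yw' w)²)) 0 1).
Proof.
apply has_length_smooth; try lra; intros.
- apply xw_cont.
- apply yw_cont.
- apply xw_deriv; lra.
- apply yw_deriv; lra.
- apply xw'_cont.
- apply yw'_cont.
Qed.

Lemma octant_speed w :
  sqrt ((xw' w)² + (yw' w)²) =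
  kappa * (Rpower (base w) (- alpha s) *
    sqrt (a ^ 2 * pw w (2 * (kappa * s - 1)) + b ^ 2 * pw w (2 * (kappa - 1)))).
Proof.
rewrite <- Rmult_assoc; set (Q := Rpower _ _).
assert (HQ : 0 < Q) by apply exp_pos.
replace ((xw' w)² + (yw' w)²) with ((kappa * Q)² *
  (a ^ 2 * pw w (2 * (kappa * s - 1)) + b ^ 2 * pw w (2 * (kappa - 1)))).
- rewrite sqrt_mult_alt by apply Rle_0_sqr; rewrite sqrt_Rsqr; trivial; nra.
- unfold xw', yw'; fold Q; unfold Rsqr.
  replace (2 * (kappa * s - 1)) with ((kappa * s - 1) + (kappa * s - 1)) by ring.
  replace (2 * (kappa - 1)) with ((kappa - 1) + (kappa - 1)) by ring.
  rewrite !pw_plus by lra; ring.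
Qed.

(** At this angle sin = (b/a) w^kappa cos, so the sum in the polar equation is (cos / a)^s times
    [base w]. *)
Lemma superellipse_atan w : 0 <= w ->
  superellipse a b s (atan (b / a * pw w kappa)) = (xw w, yw w).
Proof.
intros Hw; set (p := pw w kappa); assert (Hp : 0 <= p) by apply pw_ge0.
set (th := atan (b / a * p)).
assert (Hab : 0 < b / a) by (now apply Rdiv_lt_0_compat).
assert (HC : 0 < cos th).
{ unfold th; rewrite cos_atan; apply Rdiv_lt_0_compat; [lra|].
  apply sqrt_lt_R0; generalize (Rle_0_sqr (b / a * p)); lra. }
assert (HS : sin th = b / a * p * cos th).
{ unfold th; rewrite sin_atan, cos_atan; unfold Rdiv; ring. }
assert (HS0 : 0 <= sin th).
{ rewrite HS; apply Rmult_le_pos; [|lra]; apply Rmult_le_pos; lra. }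
assert (Hcos : rpow (Rabs (cos th)) s / rpow a s = Rpower (cos th / a) s).
{ rewrite Rabs_pos_eq by lra; unfold rpow.
  destruct (Rlt_dec 0 (cos th)); [|lra]; destruct (Rlt_dec 0 a); [|lra].
  apply Rmult_eq_reg_r with (Rpower a s); [|apply Rgt_not_eq, exp_pos].
  rewrite Rpower_mult_distr by (trivial; now apply Rdiv_lt_0_compat).
  unfold Rdiv; rewrite Rmult_assoc, Rinv_l by (apply Rgt_not_eq, exp_pos).
  rewrite Rmult_1_r; f_equal; field; lra. }
assert (Hsin : rpow (Rabs (sin th)) s / rpow b s = Rpower (cos th / a) s * pw p s).
{ rewrite Rabs_pos_eq by lra; unfold rpow; destruct (Rlt_dec 0 b); [|lra].
  destruct Hp as [Hp|Hp].
  - assert (Hsp : 0 < sin th) by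
      (rewrite HS; apply Rmult_lt_0_compat; [apply Rmult_lt_0_compat|]; lra).
    destruct (Rlt_dec 0 (sin th)); [|lra].
    rewrite (pw_pos p) by trivial.
    rewrite Rpower_mult_distr by (trivial; now apply Rdiv_lt_0_compat).
    apply Rmult_eq_reg_r with (Rpower b s); [|apply Rgt_not_eq, exp_pos].
    unfold Rdiv at 1; rewrite Rmult_assoc, Rinv_l by (apply Rgt_not_eq, exp_pos).
    rewrite Rpower_mult_distr; trivial.
    + rewrite Rmult_1_r, HS; f_equal; field; lra.
    + apply Rmult_lt_0_compat; trivial; now apply Rdiv_lt_0_compat.
  (* On the axis the convention 0^s = 0 of [rpow] and [pw] is what counts. *)
  - assert (Hsp : sin th = 0) by (rewrite HS, <- Hp; ring).
    destruct (Rlt_dec 0 (sin th)); [lra|].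
    rewrite <- Hp, pw_le0 by lra; unfold Rdiv; ring. }
assert (HR : superellipse_radius a b s th = a / cos th * X w).
{ unfold superellipse_radius; rewrite Hcos, Hsin.
  unfold p; rewrite pw_mult by lra; fold p.
  replace (Rpower (cos th / a) s + Rpower (cos th / a) s * pw w (kappa * s))
    with (Rpower (cos th / a) s * base w) by (unfold base; ring).
  rewrite <- Rpower_mult_distr; [|apply exp_pos|generalize (base_ge1 w); lra].
  unfold X; f_equal; rewrite Rpower_mult.
  replace (s * - (1 / s)) with (- (1)) by (field; lra).
  rewrite Rpower_Ropp, Rpower_1 by (now apply Rdiv_lt_0_compat).
  field; lra. }
unfold superellipse; rewrite HR, HS; unfold xw, yw; fold p; f_equal; field; lra.
Qed.

Lemma superellipse_octant_length :
  has_length (superellipse a b s) 0 (atan (b / a))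
    (RInt (fun w => kappa * (Rpower (1 + pw w (kappa * s)) (- alpha s) *
      sqrt (a ^ 2 * pw w (2 * (kappa * s - 1)) + b ^ 2 * pw w (2 * (kappa - 1))))) 0 1).
Proof.
assert (Hab : 0 < b / a) by (now apply Rdiv_lt_0_compat).
assert (Hab' : 0 < a / b) by (now apply Rdiv_lt_0_compat).
assert (Hk : 0 < / kappa) by (apply Rinv_0_lt_compat; lra).
rewrite <- (RInt_ext (fun w => sqrt ((xw' w)² + (yw' w)²)))
  by (intros w _; apply octant_speed).
assert (Hrange : forall t, 0 <= t <= atan (b / a) -> - (PI / 2) < t < PI / 2).
{ intros t Ht; generalize (atan_bound (b / a)) PI_RGT_0; lra. }
(* The solution [w] of tan t = (b/a) w^kappa. *)
set (psi := fun t => pw (a / b * tan t) (/ kappa)).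
set (phi := fun w => atan (b / a * pw w kappa)).
assert (Hphi : forall t, 0 <= t <= atan (b / a) -> phi (psi t) = t).
{ intros t Ht; unfold phi, psi; rewrite pw_mult by lra.
  assert (0 <= tan t).
  { destruct (proj1 Ht) as [H|<-]; [left|rewrite tan_0; lra].
    apply tan_gt_0; trivial; now apply Hrange. }
  rewrite Rinv_l, pw_1r by (trivial; nra).
  replace (b / a * (a / b * tan t)) with (tan t) by (field; lra).
  now apply atan_tan, Hrange. }
assert (Hpsi0 : forall t, 0 <= psi t) by (intros; apply pw_ge0).
apply has_length_reparam with (phi := phi) (psi := psi)
  (c := 0) (d := 1) (g1 := fun w => (xw w, yw w)).
- unfold phi; rewrite pw_le0, Rmult_0_r by lra; apply atan_0.
- unfold phi; now rewrite pw_1l, Rmult_1_r.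
- unfold psi; rewrite tan_0, Rmult_0_r; apply pw_le0; lra.
- unfold psi; rewrite tan_atan; replace (a / b * (b / a)) with 1 by (field; lra).
  apply pw_1l.
- intros x y _ Hxy _; unfold phi.
  assert (H : b / a * pw x kappa <= b / a * pw y kappa).
  { apply Rmult_le_compat_l; [lra|apply pw_incr; lra]. }
  destruct H as [H|H]; [left; now apply atan_increasing|rewrite H; lra].
- intros x y Hx Hxy Hy; unfold psi; apply pw_incr; [lra|].
  apply Rmult_le_compat_l; [lra|].
  destruct Hxy as [Hxy|<-]; [left|lra].
  assert (Hx' := Hrange x ltac:(lra)); assert (Hy' := Hrange y ltac:(lra)).
  apply tan_increasing; lra.
- intros w Hw; apply superellipse_atan; lra.
- intros t Ht; rewrite <- (superellipse_atan (psi t)) by trivial.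
  now rewrite <- (Hphi t Ht) at 2.
- apply octant_curve_length.
Qed.

End Octant.

Lemma superellipse_radius_sym a b s th K :
  Rabs (cos (K - th)) = Rabs (cos th) -> Rabs (sin (K - th)) = Rabs (sin th) ->
  superellipse_radius a b s (K - th) = superellipse_radius a b s th.
Proof. unfold superellipse_radius; now intros -> ->. Qed.

(** Each stage glues an arc to a mirror image under theta -> K - theta: K = PI / 2 exchanges the
    axes and with them [a] and [b], K = PI reverses x, K = 2 PI reverses y. *)
Lemma perimeter_octants a b s La Lb : 0 < a -> 0 < b ->
  has_length (superellipse a b s) 0 (atan (b / a)) La ->
  has_length (superellipse b a s) 0 (atan (a / b)) Lb ->
  perimeter a b s = Finite (4 * (La + Lb)).
Proof.
intros Ha Hb HA HB; apply has_length_arc_length.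
assert (Hba : 0 < b / a) by (now apply Rdiv_lt_0_compat).
assert (Hat : 0 < atan (b / a) < PI / 2).
{ split; [rewrite <- atan_0; now apply atan_increasing|apply atan_bound]. }
assert (Hpi := PI_RGT_0).
assert (HQ : has_length (superellipse a b s) 0 (PI / 2) (La + Lb)).
{ apply has_length_cat with (atan (b / a)); [lra|trivial|].
  replace (atan (b / a)) with (PI / 2 - atan (a / b)).
  2:{ replace (a / b) with (/ (b / a)) by (field; lra).
      rewrite atan_inv by trivial; ring. }
  replace (PI / 2) with (PI / 2 - 0) at 2 by ring.
  apply has_length_reflect with (2 := HB); intros x y _ _.
  assert (E : forall t, superellipse a b s (PI / 2 - t) =
    (snd (superellipse b a s t), fst (superellipse b a s t))).
  { intros t; unfold superellipse, superellipse_radius; simpl.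
    rewrite cos_shift, sin_shift; do 2 f_equal; f_equal; ring. }
  rewrite !E; unfold pdist, dist_euc; simpl; f_equal; ring. }
assert (HH : has_length (superellipse a b s) 0 PI ((La + Lb) + (La + Lb))).
{ apply has_length_cat with (PI / 2); [lra|trivial|].
  replace PI with (PI - 0) at 2 by ring.
  replace (PI / 2) with (PI - PI / 2) by lra.
  apply has_length_reflect with (2 := HQ); intros x y _ _.
  assert (E : forall t, superellipse a b s (PI - t) =
    (- fst (superellipse a b s t), snd (superellipse a b s t))).
  { intros t; unfold superellipse; simpl.
    rewrite superellipse_radius_sym.
    - rewrite sin_PI_x, Rtrigo_facts.cos_pi_minus; f_equal; ring.
    - now rewrite Rtrigo_facts.cos_pi_minus, Rabs_Ropp.
    - now rewrite sin_PI_x. }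
  rewrite !E; unfold pdist, dist_euc; simpl; f_equal; unfold Rsqr; ring. }
replace (4 * (La + Lb)) with (((La + Lb) + (La + Lb)) + ((La + Lb) + (La + Lb))) by ring.
apply has_length_cat with PI; [lra|trivial|].
replace (2 * PI) with (2 * PI - 0) by ring.
replace PI with (2 * PI - PI) at 1 by ring.
apply has_length_reflect with (2 := HH); intros x y _ _.
assert (E : forall t, superellipse a b s (2 * PI - t) =
  (fst (superellipse a b s t), - snd (superellipse a b s t))).
{ assert (Ec : forall t, cos (2 * PI - t) = cos t).
  { intros t; rewrite cos_minus, cos_2PI, sin_2PI; ring. }
  assert (Es : forall t, sin (2 * PI - t) = - sin t).
  { intros t; rewrite sin_minus, cos_2PI, sin_2PI; ring. }
  intros t; unfold superellipse; simpl.
  rewrite superellipse_radius_sym, Ec, Es; [f_equal; ring| |].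
  - now rewrite Ec.
  - now rewrite Es, Rabs_Ropp. }
rewrite !E; unfold pdist, dist_euc; simpl; f_equal; unfold Rsqr; ring.
Qed.

(** * The perimeter *)

Lemma is_abel_sum_ext c c' l :
  (forall k, c' k = c k) -> is_abel_sum c l -> is_abel_sum c' l.
Proof.
intros E [H1 H2]; split.
- intros e He; destruct (H1 e He) as [x Hx]; exists x.
  apply is_series_ext with (2 := Hx); intros k; now rewrite E.
- eapply filterlim_ext with (2 := H2); intros e; apply Series_ext; intros k.
  now rewrite E.
Qed.

Lemma first_term_lame a b s v k :
  first_term a b s v k = lame_term (- (1 / 2)) ((b / a) ^ 2) (alpha s) 1 v k.
Proof.
unfold first_term, lame_term, bin; rewrite pow_mult.
replace (- (1)) with (-1) by ring; unfold Rdiv; ring.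
Qed.

Lemma second_term_lame a b s u k :
  second_term a b s u k = lame_term (alpha s) 1 (- (1 / 2)) ((a / b) ^ 2) u k.
Proof.
unfold second_term, lame_term, bin; rewrite pow1.
replace (a ^ 2 / b ^ 2) with ((a / b) ^ 2) by (unfold Rdiv; rewrite Rpow_mult_distr, pow_inv; ring).
unfold Rdiv; ring.
Qed.

Lemma lame_factor_sqrt a b tau w : 0 < a ->
  a * lame_factor (- (1 / 2)) ((b / a) ^ 2) tau w = sqrt (a ^ 2 + b ^ 2 * pw w tau).
Proof.
intros Ha; unfold lame_factor.
replace (- - (1 / 2)) with (/ 2) by field.
assert (H : 0 < 1 + (b / a) ^ 2 * pw w tau).
{ generalize (pw_ge0 w tau) (pow2_ge_0 (b / a)); intros; nra. }
rewrite Rpower_sqrt by trivial.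
rewrite <- (sqrt_pow2 a) at 1 by lra; rewrite <- sqrt_mult_alt by apply pow2_ge_0.
f_equal; field; lra.
Qed.

Lemma RInt_lame_integral c q1 c1 tau1 q2 c2 tau2 (f : R -> R) :
  0 <= c1 -> 0 <= tau1 -> 0 <= c2 -> 0 <= tau2 ->
  (forall w, 0 < w < 1 -> f w = c * (lame_factor q1 c1 tau1 w * lame_factor q2 c2 tau2 w)) ->
  RInt f 0 1 = c * lame_integral q1 c1 tau1 q2 c2 tau2.
Proof.
intros Hc1 Ht1 Hc2 Ht2 Hf.
transitivity (RInt (fun w =>
  scal c (lame_factor q1 c1 tau1 w * lame_factor q2 c2 tau2 w)) 0 1).
- apply RInt_ext; rewrite Rmin_left, Rmax_right by lra; exact Hf.
- apply (RInt_scal (V := R_CompleteNormedModule)), ex_RInt_01; intros t _.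
  apply @continuous_mult; now apply continuous_lame_factor.
Qed.

(** With kappa = 1 the power beside b^2 is 1, so [b] comes out of the root and leaves the ratio a /
    b. *)
Lemma octant_length_gt1 a b s : 0 < a -> 0 < b -> 1 < s ->
  has_length (superellipse a b s) 0 (atan (b / a))
    (b * lame_integral (alpha s) 1 s (- (1 / 2)) ((a / b) ^ 2) (2 * (s - 1))).
Proof.
intros Ha Hb Hs.
rewrite <- (RInt_lame_integral b) with (f := fun w => 1 *
  (Rpower (1 + pw w (1 * s)) (- alpha s) *
    sqrt (a ^ 2 * pw w (2 * (1 * s - 1)) + b ^ 2 * pw w (2 * (1 - 1))))); try lra.
- apply superellipse_octant_length; lra.
- apply pow2_ge_0.
- intros w _; rewrite !Rmult_1_l, Rminus_diag, Rmult_0_r, pw_0r, Rmult_1_r.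
  rewrite (Rplus_comm (a ^ 2 * _)), <- lame_factor_sqrt by trivial.
  unfold lame_factor at 2; rewrite Rmult_1_l; ring.
Qed.

(** With kappa = 1 / s the power beside a^2 is 1, so [a] comes out of the root; the further 1 / s is
    the factor kappa of the speed. *)
Lemma octant_length_lt1 a b s : 0 < a -> 0 < b -> 0 < s < 1 ->
  has_length (superellipse a b s) 0 (atan (b / a))
    (a / s * lame_integral (alpha s) 1 1 (- (1 / 2)) ((b / a) ^ 2) (2 * (1 / s - 1))).
Proof.
intros Ha Hb Hs.
assert (H1 : 1 <= 1 / s).
{ apply Rmult_le_reg_r with s; [lra|]; unfold Rdiv; rewrite Rmult_assoc, Rinv_l; lra. }
assert (H2 : 1 / s * s = 1) by (field; lra).
rewrite <- (RInt_lame_integral (a / s)) with (f := fun w => 1 / s *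
  (Rpower (1 + pw w (1 / s * s)) (- alpha s) *
    sqrt (a ^ 2 * pw w (2 * (1 / s * s - 1)) + b ^ 2 * pw w (2 * (1 / s - 1))))); try lra.
- apply superellipse_octant_length; lra.
- apply pow2_ge_0.
- intros w _; rewrite H2, Rminus_diag, Rmult_0_r, pw_0r, Rmult_1_r.
  rewrite <- lame_factor_sqrt by trivial.
  unfold lame_factor at 2; rewrite Rmult_1_l; unfold Rdiv; ring.
Qed.

Theorem theorem3p2 (a b s : R) (hb : 0 < b) (hab : b <= a)
    (hs : 0 < s) (hs1 : s <> 1) :
  (1 < s ->
     exists S1 S2 : R,
       is_series (first_term a b s (v_plus s)) S1 /\
       is_series (second_term a b s (u_plus s)) S2 /\
       perimeter a b s = Finite (4 * a / s * S1 + 2 * b / (s - 1) * S2)) /\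
  (s < 1 ->
     exists S1 S2 : R,
       is_abel_sum (first_term a b s (v_minus s)) S1 /\
       is_abel_sum (second_term a b s (u_minus s)) S2 /\
       perimeter a b s = Finite (4 * a / s * S1 + 2 * b / (1 - s) * S2)).
Proof.
assert (ha : 0 < a) by lra.
assert (Hc : 0 <= (b / a) ^ 2 <= 1).
{ split; [apply pow2_ge_0|]; rewrite <- (pow1 2); apply pow_incr; split.
  - left; now apply Rdiv_lt_0_compat.
  - apply Rmult_le_reg_r with a; trivial; unfold Rdiv; rewrite Rmult_assoc, Rinv_l; lra. }
assert (Hc' : 0 <= (a / b) ^ 2) by apply pow2_ge_0.
assert (His : 0 < 1 / s) by (apply Rdiv_lt_0_compat; lra).
assert (Hal : -1 <= alpha s) by (unfold alpha; lra).
split; intros Hs.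
- assert (His1 : 1 / s < 1).
  { apply Rmult_lt_reg_r with s; trivial; unfold Rdiv; rewrite Rmult_assoc, Rinv_l; lra. }
  (* Expanding the root produces [v_plus], expanding the other factor [u_plus]. The octant at the
     x-axis yields the second series, the octant at the y-axis the first. *)
  exists (s * lame_integral (- (1 / 2)) ((b / a) ^ 2) (2 * (s - 1)) (alpha s) 1 s),
    (2 * (s - 1) * lame_integral (alpha s) 1 s (- (1 / 2)) ((a / b) ^ 2) (2 * (s - 1))).
  split; [|split].
  + eapply is_series_ext; [intros k; symmetry; apply first_term_lame|].
    apply is_series_lame_conv; trivial; try lra.
    * intros k; unfold v_plus; f_equal; ring.
    * apply Rabs_def1; lra.
  + eapply is_series_ext; [intros k; symmetry; apply second_term_lame|].
    apply is_series_lame_conv; trivial; try lra.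
    apply Rabs_def1; unfold alpha; lra.
  + rewrite (perimeter_octants a b s _ _ ha hb (octant_length_gt1 a b s ha hb Hs)
      (octant_length_gt1 b a s hb ha Hs)).
    rewrite (lame_integral_sym (- (1 / 2))); f_equal; field; lra.
- assert (His1 : 1 < 1 / s).
  { apply Rmult_lt_reg_r with s; trivial; unfold Rdiv; rewrite Rmult_assoc, Rinv_l; lra. }
  (* The octants trade places: the one at the x-axis now yields the first series. *)
  exists (1 * lame_integral (- (1 / 2)) ((b / a) ^ 2) (2 * (1 / s - 1)) (alpha s) 1 1),
    (2 * (1 / s - 1) *
      lame_integral (alpha s) 1 1 (- (1 / 2)) ((a / b) ^ 2) (2 * (1 / s - 1))).
  split; [|split].
  + eapply is_abel_sum_ext; [intros k; apply first_term_lame|].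
    apply is_abel_sum_lame; trivial; try lra.
    intros k; unfold v_minus; field; lra.
  + eapply is_abel_sum_ext; [intros k; apply second_term_lame|].
    apply is_abel_sum_lame; trivial; try lra.
    intros k; unfold u_minus; field; lra.
  + rewrite (perimeter_octants a b s _ _ ha hb (octant_length_lt1 a b s ha hb (conj hs Hs))
      (octant_length_lt1 b a s hb ha (conj hs Hs))).
    rewrite (lame_integral_sym (- (1 / 2))); f_equal; field; lra.
Qed.
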